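(* Let $(G,\Gamma)$ be a Hecke pair, let $V$ be a unitary Hecke module, let $q\ge1$ and $g\in G$. Then: (1) $T_{\Gamma g\Gamma}$ is a bounded operator on the pre-Hilbert space $L_q(\Gamma,V)$ with operator norm $\|T_{\Gamma g\Gamma}\|\le|\Gamma g\Gamma/\Gamma|$. (2) For every normal congruence subgroup $\Sigma$ of $\Gamma$ and all $v,w\in\bar H_q(\Sigma,V)$ (viewed in $L_q(\Gamma,V)$), $$\langle T_{\Gamma g\Gamma}v,w\rangle\=\frac{|\Sigma g\Sigma/\Sigma|}{|\Sigma g^{-1}\Sigma/\Sigma|}\,\langle v,T_{\Gamma g^{-1}\Gamma}w\rangle,$$ i.e. the adjoint is $T_{\Gamma g\Gamma}^*=\frac{|\Sigma g\Sigma/\Sigma|}{|\Sigma g^{-1}\Sigma/\Sigma|}T_{\Gamma g^{-1}\Gamma}$. (3) If $\Gamma g\Gamma=\Gamma g^{-1}\Gamma$, then $T_{\Gamma g\Gamma}$ is self-adjoint. (4) If there exists a locally compact group $G^*$ containing $G$ as a subgroup such that $\Gamma$ is a lattice in $G^*$, then $T_{\Gamma g\Gamma}^*=T_{\Gamma g^{-1}\Gamma}$ for every $g\in G$.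
   Context: A Hecke pair $(G,\Gamma)$: $G$ a group, $\Gamma$ a subgroup with $\Gamma g\Gamma/\Gamma$ finite for all $g$. Let $V$ be a ${\mathbb C}[G]$-module. For a subgroup $\Sigma$ of $G$: $I_\Sigma$ is the augmentation ideal of ${\mathbb C}[\Sigma]$, $H_q^0(\Sigma,V)=\{v:I_\Sigma^{q+1}v=0\}$, $H^0_{-1}=0$, $\bar H_q(\Sigma,V)=H_q^0(\Sigma,V)/H_{q-1}^0(\Sigma,V)$; for $\Sigma'\subset\Sigma$ the inclusions $H^0_q(\Sigma,V)\subset H^0_q(\Sigma',V)$ induce restriction maps $\bar H_q(\Sigma,V)\to\bar H_q(\Sigma',V)$. For $\Sigma$ normal of finite index in $\Gamma$ and $g\in G$, $\Sigma(g)$ is the kernel of the left-multiplication action of $\Sigma$ on $\Gamma g\Gamma/\Sigma$. Congruence subgroups of $\Gamma$: subgroups containing some iterated $\Gamma(g_1)(g_2)\cdots(g_n)$, $g_i\in G$; intersections of congruence subgroups are congruence subgroups. $L_q(\Gamma,V)=\varinjlim_\Sigma\bar H_q(\Sigma,V)$ over normal congruence subgroups $\Sigma$ of $\Gamma$. The Hecke operator: for $\Sigma$ normal of finite index, $T_{\Gamma g\Gamma}[v]=[\frac1{[\Gamma:\Sigma]}\sum_jh_jv]\in\bar H_q(\Sigma(g),V)$ where $\Gamma g\Gamma=\dot\bigcup_jh_j\Sigma$; these are well defined and compatible with restriction, inducing $T_{\Gamma g\Gamma}$ on $L_q(\Gamma,V)$. $V$ is a unitary Hecke module if for every $q\ge1$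 and every congruence subgroup $\Sigma$ of $\Gamma$, $\bar H_q(\Sigma,V)$ carries a Hilbert space structure such that (i) for congruence subgroups $\Sigma'\subset\Sigma$ the restriction $\bar H_q(\Sigma,V)\to\bar H_q(\Sigma',V)$ is an isometry, and (ii) each $g\in G$ acts unitarily, i.e. the map $[v]\mapsto[gv]$ from $\bar H_q(\Sigma,V)$ to $\bar H_q(\Sigma'',V)$ preserves inner products for every congruence subgroup $\Sigma''\subset g\Sigma g^{-1}$. By (i), $L_q(\Gamma,V)$ inherits a pre-Hilbert space structure (two classes are compared in a common $\bar H_q(\Sigma,V)$). A lattice in a locally compact group is a discrete subgroup with finite-covolume quotient. *)

(* Defs.v *)
From HB Require Import structures.
From mathcomp Require Import all_boot all_order all_algebra.
From mathcomp Require Import complex finmap.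
From mathcomp Require Import all_classical all_reals all_analysis.
From mathcomp Require monalg.
Import (canonicals) monalg.

Set Implicit Arguments.
Unset Strict Implicit.
Unset Printing Implicit Defensive.

Import Order.TTheory GRing.Theory Num.Theory.
Import numFieldNormedType.Exports.

Local Open Scope classical_set_scope.
Local Open Scope ring_scope.

Section Groups.
Variable G : groupType.
Implicit Types (A B S H : set G) (g h x y : G).

Definition is_subgroup S : Prop :=
  [/\ S 1%g, forall x y, S x -> S y -> S (x * y)%g & forall x, S x -> S (x^-1)%g].

Record subgroup := Subgroup {
  subgroup_set :> set G;
  subgroupP : is_subgroup subgroup_set }.

Definition lcoset x S : set G := [set (x * s)%g | s in S].

Definition lcosets A S : set (set G) := [set lcoset x S | x in A].

(* |A/S|; the value is 0 when A/S is infinite. *)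
Definition ncosets A S : nat := #|` fset_set (lcosets A S)|%fset.

Definition dcoset H g : set G := [set (a * g * b)%g | a in H & b in H].

Definition conjset g S : set G := [set (g * s * g^-1)%g | s in S].

Definition is_normal_in S H : Prop :=
  [/\ is_subgroup S, S `<=` H
    & forall x s, H x -> S s -> S (x * s * x^-1)%g].

Definition hecke_pair H : Prop :=
  forall g, finite_set (lcosets (dcoset H g) H).

(* Sigma(g) for S = Sigma and H = Gamma. *)
Definition hker H S g : set G :=
  [set s | S s /\ forall h, dcoset H g h -> lcoset (s * h)%g S = lcoset h S].

Definition congruence H S : Prop :=
  [/\ is_subgroup S, S `<=` H
    & exists gs : seq G, foldl (hker H) H gs `<=` S].

Definition normal_congruence H S : Prop := congruence H S /\ is_normal_in S H.

End Groups.

HB.mixin Record Lmodule_isGModule (K : comNzRingType) (G : groupType) V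
    of GRing.Lmodule K V := {
  gact : G -> V -> V;
  gact_is_linear : forall g, linear (gact g);
  gact1 : forall v, gact 1%g v = v;
  gactM : forall g h v, gact (g * h)%g v = gact g (gact h v) }.

#[short(type="gmodType")]
HB.structure Definition GModule (K : comNzRingType) (G : groupType) :=
  { V of Lmodule_isGModule K G V & GRing.Lmodule K V }.


Section Subquotients.
Local Open Scope quotient_scope.
Variables (K : nzRingType) (V : lmodType K).

Record submod := Submod {
  submod_pred :> {pred V};
  submodP : submod_closed submod_pred }.

HB.instance Definition _ (A : submod) :=
  GRing.isSubmodClosed.Build K V (submod_pred A) (submodP A).

Variables A B : submod.

Inductive submod_of : predArgType := SubmodOf u & u \in A.
Definition submod_val (w : submod_of) : V := let: SubmodOf u _ := w in u.
HB.instance Definition _ := [isSub of submod_of for submod_val].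
HB.instance Definition _ := [Choice of submod_of by <:].
HB.instance Definition _ := [SubChoice_isSubZmodule of submod_of by <:].
HB.instance Definition _ := [SubZmodule_isSubLmodule of submod_of by <:].

Definition sq_pred : {pred submod_of} := [pred u | val u \in B].

Fact sq_pred_closed : zmod_closed sq_pred.
Proof.
split; first by rewrite inE /= rpred0.
by move=> u v; rewrite !inE /= => uB vB; rewrite rpredB.
Qed.

HB.instance Definition _ := GRing.isZmodClosed.Build submod_of sq_pred
  sq_pred_closed.

(* A / (A \cap B), which is A / B as soon as B is contained in A; see H0prev_sub
   for the instances used below. *)
Definition subquot : Type := Quotient.quot sq_pred.
HB.instance Definition _ := GRing.Zmodule.on subquot.

Definition sq_pi (u : submod_of) : subquot := \pi_(Quotient.quot sq_pred) u.
Definition sq_repr (x : subquot) : submod_of := repr (x : Quotient.quot sq_pred).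

(* The class of v, for v in A; the value outside A is junk. *)
Definition cls (v : V) : subquot := sq_pi (insubd 0 v).
Definition sq_rep (x : subquot) : V := val (sq_repr x).

Lemma sq_rep_in x : sq_rep x \in A.
Proof. exact: valP. Qed.

Lemma cls_rep x : cls (sq_rep x) = x.
Proof. by rewrite /cls /sq_rep valKd /sq_pi /sq_repr reprK. Qed.

Lemma eq_cls u v : u \in A -> v \in A -> (cls u == cls v) = (u - v \in B).
Proof.
move=> uA vA; rewrite /cls /sq_pi -Quotient.idealrBE inE /=.
by rewrite -!/(val _) !insubdK.
Qed.

Lemma cls_rep_sub v : v \in A -> sq_rep (cls v) - v \in B.
Proof. by move=> vA; rewrite -eq_cls ?sq_rep_in// cls_rep. Qed.

Lemma clsD : {in A &, {morph cls : u v / u + v}}.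
Proof.
move=> u v uA vA; rewrite /cls /sq_pi.
have -> : insubd 0 (u + v) = insubd 0 u + insubd 0 v :> submod_of.
  by apply: val_inj; rewrite raddfD /= !insubdK// rpredD.
by rewrite Quotient.pi_add.
Qed.

Definition sq_scale (a : K) (x : subquot) : subquot := cls (a *: sq_rep x).

Lemma sq_scale_cls a v : v \in A -> sq_scale a (cls v) = cls (a *: v).
Proof.
move=> vA; apply/eqP; rewrite eq_cls ?rpredZ ?sq_rep_in//.
by rewrite -scalerBr rpredZ// cls_rep_sub.
Qed.

Fact sq_scaleA a b x : sq_scale a (sq_scale b x) = sq_scale (a * b) x.
Proof.
by rewrite {2}/sq_scale sq_scale_cls ?rpredZ ?sq_rep_in// scalerA.
Qed.

Fact sq_scale1 : left_id 1 sq_scale.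
Proof. by move=> x; rewrite /sq_scale scale1r cls_rep. Qed.

Fact sq_scaleDr : right_distributive sq_scale +%R.
Proof.
move=> a x y; rewrite -[x]cls_rep -[y]cls_rep -clsD ?sq_rep_in//.
rewrite !sq_scale_cls ?rpredD ?sq_rep_in// scalerDr clsD ?rpredZ ?sq_rep_in//.
Qed.

Fact sq_scaleDl x : {morph sq_scale^~ x : a b / a + b}.
Proof.
by move=> a b; rewrite /sq_scale scalerDl clsD ?rpredZ ?sq_rep_in.
Qed.

HB.instance Definition _ := GRing.Zmodule_isLmodule.Build K subquot
  sq_scaleA sq_scale1 sq_scaleDr sq_scaleDl.

Lemma clsZ a v : v \in A -> cls (a *: v) = a *: cls v.
Proof. by move=> vA; rewrite -sq_scale_cls. Qed.

End Subquotients.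

(* The map [v] |-> [f v] between subquotients. It is meaningful only when f
   sends A to A' and B to B'; see sqmapE. *)
Section SubquotientMap.
Variables (K : nzRingType) (V : lmodType K) (A B A' B' : submod V).

Definition sqmap (f : V -> V) (x : subquot A B) : subquot A' B' :=
  cls A' B' (f (sq_rep x)).

Hypotheses (f : V -> V) (lin_f : linear f).
Hypotheses (fA : {in A, forall v, f v \in A'}).
Hypotheses (fB : {in A, forall v, v \in B -> f v \in B'}).

Lemma sqmapE v : v \in A -> sqmap f (cls A B v) = cls A' B' (f v).
Proof.
move=> vA; apply/eqP; rewrite eq_cls ?fA ?sq_rep_in//.
have fN : f (sq_rep (cls A B v)) - f v = f (sq_rep (cls A B v) - v).
  by rewrite -!(addrC (- _)) -!scaleN1r lin_f.
by rewrite fN; apply: fB; [rewrite rpredB ?sq_rep_in|exact: cls_rep_sub].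
Qed.

Lemma sqmap_linear : linear (sqmap f).
Proof.
move=> a x y; rewrite -[x]cls_rep -[y]cls_rep.
rewrite -clsZ ?sq_rep_in// -clsD ?rpredZ ?sq_rep_in//.
rewrite !sqmapE ?rpredD ?rpredZ ?sq_rep_in// lin_f clsD ?clsZ ?rpredZ ?fA//;
  exact: sq_rep_in.
Qed.

End SubquotientMap.

Record dirsys (K : nzRingType) := DirSys {
  ds_idx : choiceType;
  ds_le : ds_idx -> ds_idx -> Prop;
  ds_ix0 : ds_idx;
  ds_ub : ds_idx -> ds_idx -> ds_idx;
  ds_mod : ds_idx -> lmodType K;
  (* total, but meaningful only for ds_le i j *)
  ds_map : forall i j, ds_mod i -> ds_mod j;
  ds_le_refl : forall i, ds_le i i;
  ds_le_trans : forall i j k, ds_le i j -> ds_le j k -> ds_le i k;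
  ds_ubl : forall i j, ds_le i (ds_ub i j);
  ds_ubr : forall i j, ds_le j (ds_ub i j);
  ds_map_lin : forall i j, ds_le i j -> linear (@ds_map i j);
  ds_map_id : forall i x, @ds_map i i x = x;
  ds_map_comp : forall i j k x, ds_le i j -> ds_le j k ->
    @ds_map j k (@ds_map i j x) = @ds_map i k x }.

Arguments ds_map {K} d i j x.
Arguments ds_mod {K} d i.

Section DirectLimit.
Local Open Scope quotient_scope.
Variables (K : nzRingType) (D : dirsys K).
Local Notation I := (ds_idx D).
Local Notation M := (ds_mod D).
Local Notation "i <~ j" := (ds_le i j) (at level 70).
Local Notation f := (ds_map D).

Definition dl_pre : Type := {i : I & M i}.
HB.instance Definition _ := Choice.on dl_pre.

Definition dl_eqv (x y : dl_pre) : bool :=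
  `[< exists k, [/\ tag x <~ k, tag y <~ k
        & f _ k (tagged x) = f _ k (tagged y)] >].

Fact dl_eqv_equiv : equiv_class_of dl_eqv.
Proof.
split=> [x|x y|y x z].
- by apply/asboolP; exists (tag x); split=> //; exact: ds_le_refl.
- by apply/asboolP/asboolP => -[k [? ? ?]]; exists k.
- move=> /asboolP[k [xk yk exy]] /asboolP[l [yl zl eyz]].
  apply/asboolP; exists (ds_ub k l).
  have [kd ld] := (ds_ubl k l, ds_ubr k l).
  split; [exact: ds_le_trans kd|exact: ds_le_trans ld|].
  rewrite -(ds_map_comp _ xk kd) exy (ds_map_comp _ yk kd).
  by rewrite -(ds_map_comp _ yl ld) eyz (ds_map_comp _ zl ld).
Qed.

Canonical dl_equiv := EquivRelPack dl_eqv_equiv.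
Canonical dl_encModRel := defaultEncModRel dl_eqv.

Definition dirlim : Type := {eq_quot dl_eqv}.
HB.instance Definition _ := Choice.on dirlim.

Definition dl_in (i : I) (x : M i) : dirlim :=
  \pi_({eq_quot dl_eqv}) (Tagged (fun i => M i : Type) x).
Definition dl_repr (x : dirlim) : dl_pre := repr (x : {eq_quot dl_eqv}).
Definition dl_idx (x : dirlim) : I := tag (dl_repr x).
Definition dl_rep (x : dirlim) : M (dl_idx x) := tagged (dl_repr x).

Lemma dl_inP i j (x : M i) (y : M j) :
  dl_in x = dl_in y <-> exists k, [/\ i <~ k, j <~ k & f i k x = f j k y].
Proof.
split=> [/eqP|H]; last apply/eqP; rewrite /dl_in piE.
  by move=> /asboolP.
exact/asboolP.
Qed.

Lemma dl_rep_in x : dl_in (dl_rep x) = x.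
Proof.
rewrite /dl_in /dl_rep /dl_idx -[RHS]reprK -/(dl_repr x).
by case: (dl_repr x).
Qed.

Lemma dl_in_map i j (x : M i) : i <~ j -> dl_in (f i j x) = dl_in x.
Proof.
move=> ij; apply/dl_inP; exists j; split=> //; first exact: ds_le_refl.
by rewrite ds_map_id.
Qed.

Lemma dl_lift x k : dl_idx x <~ k -> exists a : M k, x = dl_in a.
Proof. by move=> xk; exists (f _ k (dl_rep x)); rewrite dl_in_map// dl_rep_in. Qed.

Definition dl_add (x y : dirlim) : dirlim :=
  let k := ds_ub (dl_idx x) (dl_idx y) in
  dl_in (f _ k (dl_rep x) + f _ k (dl_rep y)).
Definition dl_opp (x : dirlim) : dirlim := dl_in (- dl_rep x).
Definition dl_zero : dirlim := dl_in (0 : M (ds_ix0 D)).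
Definition dl_scale (a : K) (x : dirlim) : dirlim := dl_in (a *: dl_rep x).

Lemma ds_mapD i j : i <~ j -> {morph f i j : x y / x + y}.
Proof. by move=> ij x y; rewrite -[x]scale1r (ds_map_lin ij) !scale1r. Qed.

Lemma ds_map0 i j : i <~ j -> f i j 0 = 0.
Proof. by move=> ij; apply/(addrI (f i j 0)); rewrite -ds_mapD// !addr0. Qed.

Lemma ds_mapZ i j a : i <~ j -> {morph f i j : x / a *: x}.
Proof. by move=> ij x; rewrite -[_ *: x]addr0 (ds_map_lin ij) ds_map0// addr0. Qed.

Lemma ds_mapN i j : i <~ j -> {morph f i j : x / - x}.
Proof. by move=> ij x; rewrite -!scaleN1r ds_mapZ. Qed.

Lemma dl_addE i (a b : M i) : dl_add (dl_in a) (dl_in b) = dl_in (a + b).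
Proof.
rewrite /dl_add; set x := dl_in a; set y := dl_in b.
have /dl_inP[k [xk ik exa]] : dl_in (dl_rep x) = dl_in a by rewrite dl_rep_in.
have /dl_inP[l [yl il eyb]] : dl_in (dl_rep y) = dl_in b by rewrite dl_rep_in.
set u := ds_ub _ _; have [xu yu] : dl_idx x <~ u /\ dl_idx y <~ u.
  by split; [exact: ds_ubl|exact: ds_ubr].
set m := ds_ub u (ds_ub k l); apply/dl_inP; exists m.
have um : u <~ m by exact: ds_ubl.
have km : k <~ m by apply: ds_le_trans (ds_ubr _ _); exact: ds_ubl.
have lm : l <~ m by apply: ds_le_trans (ds_ubr _ _); exact: ds_ubr.
split=> //; first exact: ds_le_trans km.
rewrite !ds_mapD//; last exact: ds_le_trans km.
rewrite !ds_map_comp//.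
rewrite -(ds_map_comp _ xk km) exa (ds_map_comp _ ik km).
by rewrite -(ds_map_comp _ yl lm) eyb (ds_map_comp _ il lm).
Qed.

Lemma dl_rep_eq i (a : M i) :
  exists k, [/\ dl_idx (dl_in a) <~ k, i <~ k & f _ k (dl_rep (dl_in a)) = f i k a].
Proof. by apply/dl_inP; rewrite dl_rep_in. Qed.

Lemma dl_oppE i (a : M i) : dl_opp (dl_in a) = dl_in (- a).
Proof.
have [k [xk ik e]] := dl_rep_eq a.
by apply/dl_inP; exists k; split=> //; rewrite !ds_mapN// e.
Qed.

Lemma dl_scaleE i c (a : M i) : dl_scale c (dl_in a) = dl_in (c *: a).
Proof.
have [k [xk ik e]] := dl_rep_eq a.
by apply/dl_inP; exists k; split=> //; rewrite !ds_mapZ// e.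
Qed.

Lemma dl_zeroE i : dl_zero = dl_in (0 : M i).
Proof.
apply/dl_inP; exists (ds_ub (ds_ix0 D) i).
have [? ?] := (ds_ubl (ds_ix0 D) i, ds_ubr (ds_ix0 D) i).
by split=> //; rewrite !ds_map0.
Qed.

Lemma dl_lift2 x y : exists k (a b : M k), x = dl_in a /\ y = dl_in b.
Proof.
have [a ea] := dl_lift (ds_ubl (dl_idx x) (dl_idx y)).
have [b eb] := dl_lift (ds_ubr (dl_idx x) (dl_idx y)).
by exists (ds_ub (dl_idx x) (dl_idx y)), a, b.
Qed.

Lemma dl_lift3 x y z :
  exists k (a b c : M k), [/\ x = dl_in a, y = dl_in b & z = dl_in c].
Proof.
have [k [a [b [-> ->]]]] := dl_lift2 x y.
have [hk hz] := (ds_ubl k (dl_idx z), ds_ubr k (dl_idx z)).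
have [c ec] := dl_lift hz.
exists (ds_ub k (dl_idx z)), (f _ _ a), (f _ _ b), c.
by rewrite !dl_in_map.
Qed.

Fact dl_addA : associative dl_add.
Proof.
by move=> x y z; have [k [a [b [c [-> -> ->]]]]] := dl_lift3 x y z;
  rewrite !dl_addE addrA.
Qed.

Fact dl_addC : commutative dl_add.
Proof.
by move=> x y; have [k [a [b [-> ->]]]] := dl_lift2 x y; rewrite !dl_addE addrC.
Qed.

Fact dl_add0 : left_id dl_zero dl_add.
Proof. by move=> x; rewrite -[x]dl_rep_in (dl_zeroE (dl_idx x)) dl_addE add0r. Qed.

Fact dl_addN : left_inverse dl_zero dl_opp dl_add.
Proof.
move=> x; rewrite -[x]dl_rep_in dl_oppE dl_addE addNr -dl_zeroE//.
Qed.

HB.instance Definition _ :=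
  GRing.isZmodule.Build dirlim dl_addA dl_addC dl_add0 dl_addN.

Fact dl_scaleA a b x : dl_scale a (dl_scale b x) = dl_scale (a * b) x.
Proof. by rewrite -[x]dl_rep_in !dl_scaleE scalerA. Qed.

Fact dl_scale1 : left_id 1 dl_scale.
Proof. by move=> x; rewrite -[x]dl_rep_in dl_scaleE scale1r. Qed.

Fact dl_scaleDr : right_distributive dl_scale +%R.
Proof.
move=> c x y; have [k [a [b [-> ->]]]] := dl_lift2 x y.
by rewrite [_ + _]dl_addE !dl_scaleE scalerDr [RHS]dl_addE.
Qed.

Fact dl_scaleDl x : {morph dl_scale^~ x : a b / a + b}.
Proof.
by move=> a b; rewrite -[x]dl_rep_in !dl_scaleE scalerDl [RHS]dl_addE.
Qed.

HB.instance Definition _ := GRing.Zmodule_isLmodule.Build K dirlim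
  dl_scaleA dl_scale1 dl_scaleDr dl_scaleDl.

End DirectLimit.

Section CongruenceTheory.
Variable G : groupType.
Implicit Types (S H : set G) (g h x y : G).

Lemma lcoset_eqP S x y : is_subgroup S ->
  lcoset x S = lcoset y S <-> S (y^-1 * x)%g.
Proof.
move=> [S1 SM SV]; split=> [e|yx].
  have : lcoset y S x by rewrite -e; exists 1%g => //; rewrite mulg1.
  by case=> s Ss <-; rewrite mulKg.
apply/seteqP; split=> z [s Ss <-].
  exists (y^-1 * x * s)%g; first exact: SM.
  by rewrite -mulgA mulVKg.
exists ((y^-1 * x)^-1 * s)%g; first by apply: SM => //; exact: SV.
by rewrite invgM invgK -!mulgA mulVKg.
Qed.

Lemma hkerP H S g s : is_subgroup S ->
  hker H S g s <-> S s /\ forall h, dcoset H g h -> S (h^-1 * s * h)%g.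
Proof.
by move=> sS; split=> -[Ss hs]; split=> // h /hs; rewrite lcoset_eqP// mulgA.
Qed.

Lemma hker_sub H S g : hker H S g `<=` S.
Proof. by move=> s []. Qed.

Lemma dcosetMl H g x h : is_subgroup H -> H x -> dcoset H g h ->
  dcoset H g (x * h)%g.
Proof.
move=> [_ HM _] Hx [a Ha [b Hb <-]].
by exists (x * a)%g; [exact: HM|exists b => //; rewrite !mulgA].
Qed.

Lemma hker_subgroup H S g : is_subgroup S -> is_subgroup (hker H S g).
Proof.
move=> sS; have [S1 SM SV] := sS; split.
- by apply/hkerP => //; split=> // h _; rewrite mulg1 mulVg.
- move=> x y /hkerP-/(_ sS)[Sx hx] /hkerP-/(_ sS)[Sy hy].
  apply/hkerP => //; split=> [|h hg]; first exact: SM.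
  have -> : (h^-1 * (x * y) * h = (h^-1 * x * h) * (h^-1 * y * h))%g.
    by rewrite -!mulgA mulVKg.
  by apply: SM; [exact: hx|exact: hy].
- move=> x /hkerP-/(_ sS)[Sx hx]; apply/hkerP => //; split; first exact: SV.
  move=> h hg; have -> : (h^-1 * x^-1 * h = (h^-1 * x * h)^-1)%g.
    by rewrite !invgM invgK mulgA.
  by apply: SV; exact: hx.
Qed.

Lemma hker_normal H S g : is_subgroup H -> is_normal_in S H ->
  is_normal_in (hker H S g) H.
Proof.
move=> sH [sS SH nS]; split; first exact: hker_subgroup.
  exact: subset_trans (@hker_sub _ _ _) SH.
move=> x s Hx /hkerP-/(_ sS)[Ss hs]; apply/hkerP => //; split; first exact: nS.
move=> h hg; have -> : (h^-1 * (x * s * x^-1) * h =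
    (x^-1 * h)^-1 * s * (x^-1 * h))%g by rewrite invgM invgK !mulgA.
by apply: hs; apply: dcosetMl => //; case: sH => _ _; exact.
Qed.

Lemma hker_mono H S S' g : is_subgroup S -> is_subgroup S' -> S' `<=` S ->
  hker H S' g `<=` hker H S g.
Proof.
move=> sS sS' SS s /hkerP-/(_ sS')[Ss hs]; apply/hkerP => //.
by split=> [|h /hs]; exact: SS.
Qed.

Lemma iter_hker_normal H S gs : is_subgroup H -> is_normal_in S H ->
  is_normal_in (foldl (hker H) S gs) H.
Proof.
by move=> sH; elim: gs S => //= g gs IH S nS; apply: IH; exact: hker_normal.
Qed.

Lemma iter_hker_sub H S gs : foldl (hker H) S gs `<=` S.
Proof.
by elim: gs S => [|g gs IH] S //=; apply: subset_trans (IH _) (@hker_sub _ _ _).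
Qed.

Lemma iter_hker_mono H S S' gs : is_subgroup S -> is_subgroup S' ->
  S' `<=` S -> foldl (hker H) S' gs `<=` foldl (hker H) S gs.
Proof.
elim: gs S S' => [|g gs IH] S S' sS sS' SS //=.
by apply: IH; [exact: hker_subgroup..|exact: hker_mono].
Qed.

Lemma is_normal_refl H : is_subgroup H -> is_normal_in H H.
Proof.
move=> sH; split=> // x s Hx Hs; case: sH => _ HM HV.
by apply/HM; [apply/HM|apply/HV].
Qed.

Lemma is_subgroupI S S' : is_subgroup S -> is_subgroup S' ->
  is_subgroup (S `&` S').
Proof.
move=> [S1 SM SV] [S1' SM' SV']; split=> //.
  by move=> x y [? ?] [? ?]; split; [exact: SM|exact: SM'].
by move=> x [? ?]; split; [exact: SV|exact: SV'].
Qed.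

Lemma congruenceI H S S' : is_subgroup H ->
  congruence H S -> congruence H S' -> congruence H (S `&` S').
Proof.
move=> sH [sS SH [gs hgs]] [sS' _ [gs' hgs']]; split; first exact: is_subgroupI.
  by move=> x [/SH].
have nH gs1 : is_normal_in (foldl (hker H) H gs1) H.
  by apply: iter_hker_normal => //; exact: is_normal_refl.
exists (gs ++ gs'); rewrite foldl_cat => x hx; split.
  exact/hgs/(iter_hker_sub hx).
apply/hgs'; move: hx; apply: iter_hker_mono => //; last by case: (nH gs).
by case: (nH gs).
Qed.

Lemma normal_congruenceI H S S' : is_subgroup H ->
  normal_congruence H S -> normal_congruence H S' ->
  normal_congruence H (S `&` S').
Proof.
move=> sH [cS [sS SH nS]] [cS' [sS' _ nS']]; split; first exact: congruenceI.
split; [exact: is_subgroupI|by move=> x [/SH]|].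
by move=> x s Hx [? ?]; split; [exact: nS|exact: nS'].
Qed.

Lemma normal_congruenceT H : is_subgroup H -> normal_congruence H H.
Proof.
move=> sH; split; last exact: is_normal_refl.
by split=> //; exists [::].
Qed.

Lemma normal_congruence_hker H S g : is_subgroup H -> normal_congruence H S ->
  normal_congruence H (hker H S g).
Proof.
move=> sH [[sS SH [gs hgs]] nS]; split; last exact: hker_normal.
split; [exact: hker_subgroup|exact: subset_trans (@hker_sub _ _ _) SH|].
exists (rcons gs g); rewrite foldl_rcons; apply: hker_mono => //.
by case: (@iter_hker_normal H H gs sH (is_normal_refl sH)).
Qed.

End CongruenceTheory.

Section HigherInvariants.
Variables (K : comNzRingType) (G : groupType).

(* The K-module underlying K[G], with finitely supported functions as elements.
   The library's own product on malg is restricted to monoids without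
   nontrivial units, hence galg_mul. *)
Local Notation galg := (monalg.malg G K).
Implicit Types (a b : galg) (S : set G) (I J : set galg).

Definition galg_mul a b : galg :=
  \sum_(x <- monalg.msupp a) \sum_(y <- monalg.msupp b)
    monalg.mkmalgU (x * y)%g (monalg.mcoeff x a * monalg.mcoeff y b).

Definition aug_ideal S : set galg :=
  [set a | (forall x, x \in monalg.msupp a -> S x) /\
           \sum_(x <- monalg.msupp a) monalg.mcoeff x a = 0].

Definition ideal_mul I J : set galg :=
  [set c | exists n (a b : 'I_n -> galg),
     [/\ forall i, I (a i), forall i, J (b i)
       & c = \sum_i galg_mul (a i) (b i)]].

(* The power of exponent q.+1, not q, of the augmentation ideal. *)
Fixpoint aug_pow S (q : nat) : set galg :=
  if q is q'.+1 then ideal_mul (aug_ideal S) (aug_pow S q') else aug_ideal S.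

Lemma aug_pow_mono S S' q : S' `<=` S -> aug_pow S' q `<=` aug_pow S q.
Proof.
move=> SS; have I_mono : aug_ideal S' `<=` aug_ideal S.
  by move=> a [sa a0]; split=> // x /sa /SS.
elim: q => //= q IH c [n [a [b [Ia Jb ->]]]]; exists n, a, b.
by split=> // i; [exact/I_mono/Ia|exact/IH/Jb].
Qed.

Variable V : gmodType K G.
Implicit Types (v w : V).

Definition galg_act a v : V :=
  \sum_(x <- monalg.msupp a) monalg.mcoeff x a *: gact x v.

Lemma galg_act_linear a : linear (galg_act a).
Proof.
move=> k v w; rewrite /galg_act scaler_sumr -big_split /=.
apply: eq_bigr => x _; rewrite gact_is_linear scalerDr !scalerA.
by rewrite [k * _]mulrC.
Qed.

Definition H0_pred S q : {pred V} :=
  [pred v | `[< forall a, aug_pow S q a -> galg_act a v = 0 >]].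

Lemma H0P S q v :
  reflect (forall a, aug_pow S q a -> galg_act a v = 0) (v \in H0_pred S q).
Proof. exact: asboolP. Qed.

Fact H0_closed S q : submod_closed (H0_pred S q).
Proof.
split.
  apply/H0P => a _.
  have := galg_act_linear a (-1) 0 0.
  by rewrite scaler0 addr0 scaleN1r addNr.
move=> k v w /H0P hv /H0P hw; apply/H0P => a ha.
by rewrite galg_act_linear hv// hw// scaler0 addr0.
Qed.

Definition H0 S q : submod V := Submod (H0_closed S q).

Fact zero_submod_closed : submod_closed (pred1 (0 : V)).
Proof.
split; first by rewrite inE.
by move=> k v w; rewrite !inE => /eqP-> /eqP->; rewrite scaler0 addr0.
Qed.

(* H^0_(q-1), where H^0_(-1) = 0. *)
Definition H0prev S q : submod V :=
  if q is p.+1 then H0 S p else Submod zero_submod_closed.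

Definition Hbar q S : lmodType K := subquot (H0 S q) (H0prev S q).

Definition Hcls q S : V -> Hbar q S := cls (H0 S q) (H0prev S q).

(* [v] |-> [v], for S' contained in S *)
Definition Hres q S S' : Hbar q S -> Hbar q S' := sqmap _ _ id.

(* [v] |-> [g v], for S' contained in g S g^-1 *)
Definition Hact q S S' (g : G) : Hbar q S -> Hbar q S' := sqmap _ _ (gact g).

Lemma H0_mono S S' q : S' `<=` S -> {subset H0 S q <= H0 S' q}.
Proof.
move=> SS v /H0P hv; apply/H0P => a /(aug_pow_mono SS).
exact: hv.
Qed.

Lemma H0prev_mono S S' q : S' `<=` S -> {subset H0prev S q <= H0prev S' q}.
Proof. by case: q => [|q] SS; [move=> v|exact: H0_mono]. Qed.

End HigherInvariants.

Section HactTheory.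
Variables (K : comNzRingType) (G : groupType).
Local Notation galg := (monalg.malg G K).

Section LinearExtension.
Variables (M : lmodType K) (F : G -> M).

Definition galg_lin (a : galg) : M :=
  \sum_(x <- monalg.msupp a) monalg.mcoeff x a *: F x.

Lemma galg_linEw (d : {fset G}) (a : galg) :
  {subset monalg.msupp a <= d} ->
  galg_lin a = \sum_(x <- d) monalg.mcoeff x a *: F x.
Proof.
move=> sd; rewrite /galg_lin; apply: big_fset_incl; first exact/fsubsetP.
by move=> x _ xa; rewrite monalg.mcoeff_outdom// scale0r.
Qed.

Lemma galg_linD a b : galg_lin (a + b) = galg_lin a + galg_lin b.
Proof.
pose d := (monalg.msupp a `|` monalg.msupp b)%fset.
rewrite !(@galg_linEw d); last first.
- exact/fsubsetP/monalg.msuppD_le.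
- by apply/fsubsetP; exact: fsubsetUl.
- by apply/fsubsetP; exact: fsubsetUr.
rewrite -big_split /=; apply: eq_bigr => x _.
by rewrite monalg.mcoeffD scalerDl.
Qed.

Lemma galg_lin0 : galg_lin 0 = 0.
Proof. by rewrite /galg_lin monalg.msupp0 big_seq_fset0. Qed.

Lemma galg_lin_sum (I : Type) (r : seq I) (P : pred I) (f : I -> galg) :
  galg_lin (\sum_(i <- r | P i) f i) = \sum_(i <- r | P i) galg_lin (f i).
Proof. exact: (big_morph galg_lin galg_linD galg_lin0). Qed.

Lemma galg_linU x k : galg_lin (monalg.mkmalgU x k) = k *: F x.
Proof.
rewrite (@galg_linEw [fset x]%fset) ?big_seq_fset1 ?monalg.mcoeffUU//.
exact/fsubsetP/monalg.msuppU_le.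
Qed.

End LinearExtension.

Variable V : gmodType K G.
Implicit Types (v : V) (S : set G).

Lemma galg_actE (a : galg) v : galg_act a v = galg_lin (fun x => gact x v) a.
Proof. by []. Qed.

Lemma gactD (g : G) : {morph gact g : u w / u + w :> V}.
Proof. by move=> u w; rewrite -[u]scale1r gact_is_linear !scale1r. Qed.

Lemma gact0 (g : G) : gact g 0 = 0 :> V.
Proof. by apply/(addrI (gact g 0)); rewrite -gactD !addr0. Qed.

Lemma gact_sum (g : G) (I : Type) (r : seq I) (f : I -> V) :
  gact g (\sum_(i <- r) f i) = \sum_(i <- r) gact g (f i).
Proof. exact: (big_morph (gact g) (@gactD g) (gact0 g)). Qed.

Lemma gactZ (g : G) k v : gact g (k *: v) = k *: gact g v.
Proof. by rewrite -[_ *: v]addr0 gact_is_linear gact0 addr0. Qed.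

Lemma galg_act_mul (a b : galg) v :
  galg_act (galg_mul a b) v = galg_act a (galg_act b v).
Proof.
rewrite galg_actE /galg_mul galg_lin_sum; apply: eq_bigr => x _.
rewrite galg_lin_sum /galg_act gact_sum scaler_sumr; apply: eq_bigr => y _.
by rewrite galg_linU gactM gactZ scalerA.
Qed.

Lemma aug_conj S S' (g : G) (a : galg) : S' `<=` conjset g S ->
  aug_ideal S' a -> exists2 b : galg, aug_ideal S b &
    forall v, galg_act a (gact g v) = gact g (galg_act b v).
Proof.
move=> sSS [sa a0].
pose b : galg := \sum_(y <- monalg.msupp a)
  monalg.mkmalgU (g^-1 * y * g)%g (monalg.mcoeff y a).
exists b; last first.
  move=> v; rewrite [galg_act b v]galg_actE galg_lin_sum gact_sum.
  apply: eq_bigr => y _.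
  by rewrite galg_linU gactZ -!gactM -!mulgA mulVKg.
split.
  move=> x; rewrite -monalg.mcoeff_neq0 => bx.
  have [y ya ex] : exists2 y, y \in monalg.msupp a & (g^-1 * y * g)%g = x.
    apply: contrapT => nex; move: bx; rewrite /b raddf_sum /= big_seq big1 ?eqxx//.
    move=> y ya; rewrite monalg.mcoeffU; case: eqP => // e.
    by exfalso; apply: nex; exists y.
  have [s Ss e] := sSS _ (sa _ ya).
  by rewrite -ex -e -!mulgA mulVg mulg1 mulKg.
have := galg_lin_sum (fun=> 1 : K^o) (monalg.msupp a) xpredT
  (fun y => monalg.mkmalgU (g^-1 * y * g)%g (monalg.mcoeff y a)).
rewrite -/b => e; transitivity (galg_lin (fun=> 1 : K^o) b).
  by apply: eq_bigr => x _; rewrite -[RHS]/(_ * 1) mulr1.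
rewrite e -[RHS]a0; apply: eq_bigr => x _.
by rewrite galg_linU -[LHS]/(_ * 1) mulr1.
Qed.

Lemma aug_pow_conj S S' (g : G) q (a : galg) : S' `<=` conjset g S ->
  aug_pow S' q a -> exists2 b : galg, aug_pow S q b &
    forall v, galg_act a (gact g v) = gact g (galg_act b v).
Proof.
move=> sSS; elim: q a => [|q IH] a /=; first exact: aug_conj.
move=> [n [c [d [Ic Jd ->]]]].
have /choice[c' hc'] i : exists c' : galg, aug_ideal S c' /\
    forall v, galg_act (c i) (gact g v) = gact g (galg_act c' v).
  by have [c' ? ?] := aug_conj sSS (Ic i); exists c'.
have /choice[d' hd'] i : exists d' : galg, aug_pow S q d' /\
    forall v, galg_act (d i) (gact g v) = gact g (galg_act d' v).
  by have [d' ? ?] := IH _ (Jd i); exists d'.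
exists (\sum_i galg_mul (c' i) (d' i)).
  by exists n, c', d'; split=> // i; [case: (hc' i)|case: (hd' i)].
move=> v; rewrite !galg_actE !galg_lin_sum gact_sum; apply: eq_bigr => i _.
rewrite -!galg_actE !galg_act_mul.
by have [_ ->] := hd' i; have [_ ->] := hc' i.
Qed.

Lemma H0_gact S S' (g : G) q v : S' `<=` conjset g S ->
  v \in H0 V S q -> gact g v \in H0 V S' q.
Proof.
move=> sSS /H0P hv; apply/H0P => a /(aug_pow_conj sSS)[b hb ->].
by rewrite hv// gact0.
Qed.

Lemma H0prev_gact S S' (g : G) q v : S' `<=` conjset g S ->
  v \in H0prev V S q -> gact g v \in H0prev V S' q.
Proof.
case: q => [|q] sSS; last exact: H0_gact.
by rewrite !inE => /eqP->; rewrite gact0.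
Qed.

Lemma H0prev_sub S q : {subset H0prev V S q <= H0 V S q}.
Proof.
case: q => [|q] v; first by rewrite inE => /eqP->; rewrite rpred0.
move=> /H0P hv; apply/H0P => _ [n [c [d [_ Jd ->]]]].
rewrite galg_actE galg_lin_sum big1// => i _.
rewrite -galg_actE galg_act_mul (hv _ (Jd i)).
by have := galg_act_linear (c i) (-1) (0 : V) 0; rewrite scaler0 addr0 scaleN1r addNr.
Qed.

Lemma aug_powSr S q (a b : galg) : aug_pow S q b -> aug_ideal S a ->
  exists2 c : galg, aug_pow S q.+1 c &
    forall v, galg_act b (galg_act a v) = galg_act c v.
Proof.
move=> + Ia; elim: q b => [|q IH] b.
  move=> Ib; exists (galg_mul b a); last by move=> v; rewrite galg_act_mul.
  by exists 1%N, (fun=> b), (fun=> a); split=> //; rewrite big_ord1.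
move=> [n [c [d [Ic Jd ->]]]].
have /choice[e he] i : exists e : galg, aug_pow S q.+1 e /\
    forall v, galg_act (d i) (galg_act a v) = galg_act e v.
  by have [e ? ?] := IH _ (Jd i); exists e.
exists (\sum_i galg_mul (c i) (e i)).
  by exists n, c, e; split=> // i; case: (he i).
move=> v; rewrite !galg_actE !galg_lin_sum; apply: eq_bigr => i _.
by rewrite -!galg_actE !galg_act_mul; have [_ ->] := he i.
Qed.

Lemma H0_gact_sub S (s : G) q v : S 1%g -> S s -> v \in H0 V S q ->
  gact s v - v \in H0prev V S q.
Proof.
move=> S1 Ss /H0P hv.
pose a : galg := monalg.mkmalgU s 1 - monalg.mkmalgU 1%g 1.
have Ea (M : lmodType K) (F : G -> M) : galg_lin F a = F s - F 1%g.
  by rewrite galg_linD galg_linU -monalg.monalgUN galg_linU scaleN1r scale1r.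
have Ia : aug_ideal S a.
  split=> [x /(fsubsetP (monalg.msuppB_le _ _))|].
    by rewrite in_fsetU => /orP[] /(fsubsetP monalg.msuppU_le);
      rewrite inE => /eqP->.
  rewrite -[RHS](subrr (1 : K^o)) -(Ea _ (fun=> 1 : K^o)).
  by apply: eq_bigr => x _; rewrite -[RHS]/(_ * 1) mulr1.
have av : galg_act a v = gact s v - v by rewrite galg_actE Ea gact1.
case: q hv => [|q] hv; first by rewrite inE -av hv.
apply/H0P => b hb; rewrite -av.
by have [c hc ->] := aug_powSr hb Ia; exact: hv.
Qed.

Lemma HresE q S S' v : S' `<=` S -> v \in H0 V S q ->
  Hres S' (Hcls q S v) = Hcls q S' v.
Proof.
move=> SS vS; apply: sqmapE => //; first by move=> w; exact: H0_mono.
by move=> w _; exact: H0prev_mono.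
Qed.

Lemma HactE q S S' (g : G) v : S' `<=` conjset g S -> v \in H0 V S q ->
  Hact S' g (Hcls q S v) = Hcls q S' (gact g v).
Proof.
move=> SS vS; apply: sqmapE => //; first exact: gact_is_linear.
  by move=> w; exact: H0_gact.
by move=> w _; exact: H0prev_gact.
Qed.

End HactTheory.

Section InnerProducts.
Variables (R : realType) (M : lmodType R[i]).
Implicit Types (ip : M -> M -> R[i]) (x y : M) (T : M -> M).

Definition inner_product ip : Prop :=
  [/\ forall y, scalar (ip^~ y),
      forall x y, ip y x = (ip x y)^*%C
    & forall x, x != 0 -> 0 < ip x x].

Definition ipnorm ip x : R := Num.sqrt (complex.Re (ip x x)).

Definition ip_complete ip : Prop :=
  forall u : nat -> M,
    (forall e : R, 0 < e -> exists N, forall m n, (N <= m)%N -> (N <= n)%N ->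
       ipnorm ip (u m - u n) < e) ->
    exists l, forall e : R, 0 < e -> exists N, forall n, (N <= n)%N ->
       ipnorm ip (u n - l) < e.

Definition hilbert_space ip : Prop := inner_product ip /\ ip_complete ip.

Definition op_bound ip T (c : R) : Prop :=
  0 <= c /\ forall x, ipnorm ip (T x) <= c * ipnorm ip x.

Definition bounded_operator ip T : Prop := linear T /\ exists c, op_bound ip T c.

(* inf set0 = 0, so this is the operator norm only for a bounded T. *)
Definition opnorm ip T : R := inf [set c | op_bound ip T c].

Definition is_adjoint ip T T' : Prop := forall x y, ip (T x) y = ip x (T' y).

Definition self_adjoint ip T : Prop := is_adjoint ip T T.

End InnerProducts.

Section Hecke.
Variables (R : realType) (G : groupType) (V : gmodType R[i] G).
Variable Gam : subgroup G.

Record ncong := Ncong {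
  ncong_set :> set G;
  ncongP : normal_congruence Gam ncong_set }.
HB.instance Definition _ := gen_eqMixin ncong.
HB.instance Definition _ := gen_choiceMixin ncong.

Definition ncongI (S S' : ncong) : ncong :=
  Ncong (normal_congruenceI (subgroupP Gam) (ncongP S) (ncongP S')).

Definition ncongT : ncong := Ncong (normal_congruenceT (subgroupP Gam)).

Definition ncong_hker (S : ncong) (g : G) : ncong :=
  Ncong (normal_congruence_hker g (subgroupP Gam) (ncongP S)).

Section System.
Variable q : nat.

Fact hecke_sys_lin (S S' : ncong) : S' `<=` S ->
  linear (@Hres _ _ V q S S').
Proof.
move=> SS; apply: sqmap_linear => // v; first exact: H0_mono.
by move=> _; exact: H0prev_mono.
Qed.

Fact hecke_sys_id (S : ncong) (x : Hbar V q S) : Hres S x = x.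
Proof. exact: cls_rep. Qed.

Fact hecke_sys_comp (S S' S'' : ncong) (x : Hbar V q S) :
  S' `<=` S -> S'' `<=` S' ->
  Hres S'' (Hres S' x) = Hres S'' x.
Proof.
move=> h1 h2; rewrite /Hres {2}/sqmap sqmapE//.
- by move=> v; exact: H0_mono.
- by move=> v _; exact: H0prev_mono.
- by apply: (H0_mono h1); exact: sq_rep_in.
Qed.

Definition hecke_sys : dirsys R[i] := @DirSys R[i] ncong
  (fun S S' => S' `<=` S) ncongT ncongI
  (fun S => Hbar V q S) (fun S S' => @Hres _ _ V q S S')
  (fun S => @subset_refl _ S) (fun S S' S'' h h' => subset_trans h' h)
  (fun S S' => @subIsetl _ S S')
  (fun S S' => @subIsetr _ S S')
  hecke_sys_lin hecke_sys_id hecke_sys_comp.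

Definition Lq : lmodType R[i] := dirlim hecke_sys.

Definition Lin (S : ncong) (x : Hbar V q S) : Lq :=
  @dl_in _ hecke_sys S x.

(* xget 1 c is the representative h_j of the coset c. By hecke_mapE the induced
   map on classes depends neither on this choice nor on that of v. *)
Definition hecke_sum (S : set G) (g : G) (v : V) : V :=
  (ncosets Gam S)%:R^-1 *:
    \sum_(c \in lcosets (dcoset Gam g) S) gact (xget 1%g c) v.

Definition hecke_map (S : set G) (g : G) :
  Hbar V q S -> Hbar V q (hker Gam S g) := sqmap _ _ (hecke_sum S g).

Definition hecke_op (g : G) (x : Lq) : Lq :=
  Lin (S := ncong_hker (dl_idx x) g) (hecke_map g (dl_rep x)).

Section HeckeMapTheory.
Variables (S : set G) (g : G).
Hypotheses (nS : normal_congruence Gam S).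
Hypotheses (finS : finite_set (lcosets (dcoset Gam g) S)).

Lemma hker_conj h : dcoset Gam g h -> hker Gam S g `<=` conjset h S.
Proof.
have [[sS _ _] _] := nS.
move=> hg s /hkerP-/(_ sS)[_ /(_ _ hg) hs].
by exists (h^-1 * s * h)%g => //; rewrite -!mulgA mulVKg mulgV mulg1.
Qed.

Lemma dcoset_mem c x : lcosets (dcoset Gam g) S c -> c x -> dcoset Gam g x.
Proof.
move=> [_ [a Ga [b Gb <-]] <-] [s Ss <-].
exists a => //; exists (b * s)%g; last by rewrite !mulgA.
have [_ GM _] := subgroupP Gam; have [[_ SG _] _] := nS.
by apply: GM => //; exact: SG.
Qed.

Lemma xget_coset c : lcosets (dcoset Gam g) S c -> c (xget 1%g c).
Proof.
have [[[S1 _ _] _ _] _] := nS.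
move=> [x _ <-]; case: xgetP => [y _ //|/(_ x)[]].
by exists 1%g => //; rewrite mulg1.
Qed.

Lemma hecke_sum_linear : linear (hecke_sum S g).
Proof.
move=> k u v; rewrite /hecke_sum !fsbig_finite//=.
rewrite scalerA mulrC -scalerA -scalerDr; congr (_ *: _).
rewrite scaler_sumr -big_split /=; apply: eq_bigr => c _.
exact: gact_is_linear.
Qed.

Lemma hecke_sum_H0 v : v \in H0 V S q -> hecke_sum S g v \in H0 V (hker Gam S g) q.
Proof.
move=> vS; rewrite /hecke_sum fsbig_finite// rpredZ// big_seq rpred_sum// => c.
rewrite in_fset_set// inE => hc.
by apply: H0_gact vS; apply/hker_conj/(dcoset_mem hc); exact: xget_coset.
Qed.

Lemma hecke_sum_H0prev v :
  v \in H0prev V S q -> hecke_sum S g v \in H0prev V (hker Gam S g) q.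
Proof.
move=> vS; rewrite /hecke_sum fsbig_finite// rpredZ// big_seq rpred_sum// => c.
rewrite in_fset_set// inE => hc.
by apply: H0prev_gact vS; apply/hker_conj/(dcoset_mem hc); exact: xget_coset.
Qed.

Lemma hecke_map_linear : linear (@hecke_map S g).
Proof.
apply: sqmap_linear => [|v|v _]; first exact: hecke_sum_linear.
  exact: hecke_sum_H0.
exact: hecke_sum_H0prev.
Qed.

Lemma hecke_mapE (r : set G -> G) v :
  (forall c, lcosets (dcoset Gam g) S c -> c (r c)) -> v \in H0 V S q ->
  hecke_map g (Hcls q S v) = Hcls q (hker Gam S g)
    ((ncosets Gam S)%:R^-1 *: \sum_(c \in lcosets (dcoset Gam g) S) gact (r c) v).
Proof.
move=> hr vS.
have -> : hecke_map g (Hcls q S v) = Hcls q (hker Gam S g) (hecke_sum S g v).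
  apply: sqmapE => // [|w|w _]; first exact: hecke_sum_linear.
    exact: hecke_sum_H0.
  exact: hecke_sum_H0prev.
apply/eqP; rewrite eq_cls ?hecke_sum_H0//; last first.
  rewrite fsbig_finite// rpredZ// big_seq rpred_sum// => c.
  rewrite in_fset_set// inE => hc.
  by apply: H0_gact vS; apply/hker_conj/(dcoset_mem hc); exact: hr.
rewrite /hecke_sum !fsbig_finite// -scalerBr rpredZ// -sumrB.
rewrite big_seq rpred_sum// => c; rewrite in_fset_set// inE => hc.
have [[sS _ _] _] := nS; have [S1 SM SV] := sS.
have Ss : S ((r c)^-1 * xget 1%g c)%g.
  have [hx hr'] := (xget_coset hc, hr _ hc); move: hx hr'; case: hc => x _ <-.
  move=> [s1 Ss1 <-] [s2 Ss2 <-].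
  by rewrite invgM -mulgA mulKg; apply: SM => //; exact: SV.
have := H0_gact_sub S1 Ss vS; set w := _ - v => hw.
suff -> : gact (xget 1%g c) v - gact (r c) v = gact (r c) w.
  by apply: H0prev_gact hw; apply/hker_conj/(dcoset_mem hc); exact: hr.
by rewrite /w gactD -scaleN1r gactZ scaleN1r -gactM mulVKg.
Qed.

End HeckeMapTheory.

End System.

Record unitary_hecke_module := UnitaryHeckeModule {
  uhm_ip : forall (q : nat) (S : set G), Hbar V q S -> Hbar V q S -> R[i];
  uhm_hilbert : forall q S, (0 < q)%N -> congruence Gam S ->
    hilbert_space (@uhm_ip q S);
  uhm_isometry : forall q S S', (0 < q)%N ->
    congruence Gam S -> congruence Gam S' -> S' `<=` S ->
    forall x y : Hbar V q S, uhm_ip (Hres S' x) (Hres S' y) = uhm_ip x y;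
  uhm_unitary : forall q S S' g, (0 < q)%N ->
    congruence Gam S -> congruence Gam S' -> S' `<=` conjset g S ->
    forall x y : Hbar V q S, uhm_ip (Hact S' g x) (Hact S' g y) = uhm_ip x y }.

(* Two classes are compared at the intersection of the levels where they live;
   any common level gives the same value, by LipE. *)
Definition Lip (U : unitary_hecke_module) (q : nat) (x y : Lq q) : R[i] :=
  let S := ncongI (dl_idx x) (dl_idx y) in
  uhm_ip U (Hres S (dl_rep x)) (Hres S (dl_rep y)).

Section LipTheory.
Variables (U : unitary_hecke_module) (q : nat).
Hypothesis q_gt0 : (0 < q)%N.

Let ncong_cong (S : ncong) : congruence Gam S.
Proof. by have [] := ncongP S. Qed.

Lemma LipE (S : ncong) (x y : Hbar V q S) :
  Lip U (Lin x) (Lin y) = uhm_ip U x y.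
Proof.
have [S1 [x1 s1 ex]] := @dl_rep_eq _ (hecke_sys q) S x.
have [S2 [y2 s2 ey]] := @dl_rep_eq _ (hecke_sys q) S y.
rewrite /Lip; set I := ncongI _ _; pose J := ncongI I (ncongI S1 S2).
have JI : J `<=` I by move=> ? [].
have JS1 : J `<=` S1 by move=> ? [_ []].
have JS2 : J `<=` S2 by move=> ? [_ []].
rewrite -(uhm_isometry U q_gt0 (ncong_cong I) (ncong_cong J) JI).
rewrite (@hecke_sys_comp q _ I J)//; last exact: subIsetl.
rewrite (@hecke_sys_comp q _ I J)//; last exact: subIsetr.
have -> : Hres J (dl_rep (Lin x)) = Hres J x.
  rewrite -(@hecke_sys_comp q S S1 J)// -(@hecke_sys_comp q (dl_idx (Lin x)) S1 J)//.
  exact: (congr1 (@Hres _ _ V q S1 J) ex).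
have -> : Hres J (dl_rep (Lin y)) = Hres J y.
  rewrite -(@hecke_sys_comp q S S2 J)// -(@hecke_sys_comp q (dl_idx (Lin y)) S2 J)//.
  exact: (congr1 (@Hres _ _ V q S2 J) ey).
by apply: uhm_isometry => //; exact: subset_trans s1.
Qed.

Lemma Lip_inner_product : inner_product (@Lip U q).
Proof.
split.
- move=> y k x z.
  have [S [a [b [c [-> -> ->]]]]] := @dl_lift3 _ (hecke_sys q) x y z.
  have -> : k *: dl_in a + dl_in c = @dl_in _ (hecke_sys q) S (k *: a + c).
    by rewrite -dl_addE -dl_scaleE.
  rewrite !LipE; have [[lin _ _] _] := uhm_hilbert U q_gt0 (ncong_cong S).
  exact: lin.
- move=> x y; have [S [a [b [-> ->]]]] := @dl_lift2 _ (hecke_sys q) x y.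
  by rewrite !LipE; have [[_ + _] _] := uhm_hilbert U q_gt0 (ncong_cong S); apply.
- move=> x; rewrite -[x]dl_rep_in => nx.
  rewrite LipE; have [[_ _ +] _] := uhm_hilbert U q_gt0 (ncong_cong (dl_idx x)).
  by apply; apply: contraNneq nx => ->; rewrite -dl_zeroE.
Qed.

End LipTheory.

End Hecke.

HB.structure Definition PreTopologicalGroup :=
  { G of Topological G & Group G }.

HB.mixin Record PreTopologicalGroup_isTopologicalGroup G
    of PreTopologicalGroup G := {
  mulg_continuous : continuous (fun xy : G * G => (xy.1 * xy.2)%g);
  invg_continuous : continuous (fun x : G => (x^-1)%g) }.

#[short(type="topologicalGroupType")]
HB.structure Definition TopologicalGroup :=
  { G of PreTopologicalGroup_isTopologicalGroup G & PreTopologicalGroup G }.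

Section Lattices.
Variables (R : realType) (G : topologicalGroupType) (L : set G).

Definition locally_compact_group : Prop :=
  hausdorff_space G /\ locally_compact [set: G].

Definition lquot : Type := {c : set G | `[< exists x, c = lcoset x L >]}.
HB.instance Definition _ := Choice.on lquot.

Definition lquot_pi (x : G) : lquot :=
  exist _ (lcoset x L) (asboolT (ex_intro _ x erefl)).
Definition lquot_repr (c : lquot) : G := xget 1%g [set x | val c = lcoset x L].

Fact lquot_reprK : cancel lquot_repr lquot_pi.
Proof.
move=> c; apply: val_inj => /=; rewrite /lquot_repr.
by case: xgetP => [x _ ->//|/=]; have /asboolP[x ->] := valP c; move=> /(_ x).
Qed.

HB.instance Definition _ := isQuotient.Build G lquot lquot_reprK.

Definition coset_space : Type := quotient_topology lquot.
HB.instance Definition _ := Topological.on coset_space.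
HB.instance Definition _ := isPointed.Build coset_space (lquot_pi 1%g).

Definition borel_coset_space := g_sigma_algebraType (@open coset_space).

Definition coset_translate (g : G) (c : coset_space) : coset_space :=
  lquot_pi (g * lquot_repr c)%g.

(* A Radon measure on G/L: outer regular on Borel sets, inner regular on open
   sets. Local finiteness is automatic as mu is finite. *)
Definition radon (mu : {finite_measure set borel_coset_space -> \bar R}) : Prop :=
  (forall A : set borel_coset_space, measurable A ->
     mu A = ereal_inf [set mu W | W in
       [set W : set coset_space | open W /\ A `<=` W]]) /\
  (forall W : set coset_space, open W ->
     mu W = ereal_sup [set mu C | C in
       [set C : set coset_space | compact C /\ C `<=` W]]).

Definition finite_covolume : Prop :=
  exists mu : {finite_measure set borel_coset_space -> \bar R},
    [/\ radon mu, (0 < mu setT)%E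
      & forall g (A : set borel_coset_space), measurable A ->
          mu (coset_translate g @` A) = mu A].

Definition lattice : Prop := [/\ is_subgroup L, isolated L = L & finite_covolume].

End Lattices.

(* Main.v *)
(* Writing classes at a common level, <T_g v, w> is the average over the cosets
   x S of Gamma g Gamma of <x v, w> = <v, x^-1 w>, a function of x that is
   bi-invariant under S. Since S is normal in Gamma, |S x S / S| is constant on
   Gamma g Gamma, and a double count of the pairs (x S, y S) with y in S x^-1 S
   turns the sum over left cosets into a sum over inverses, at the cost of the
   ratio |S g S / S| / |S g^-1 S / S|; the same count with the constant function
   shows that this ratio does not depend on S. The norm bound holds because the
   average has |Gamma g Gamma / Gamma| [Gamma : S] terms, all of norm |v|.

   For a lattice L in T with invariant measure mu on T/L, let lam A be the
   measure of the image of an open set A. On small sets lam is a Haar measure;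
   comparing lam with its right translates gives a modulus, which is trivial on
   L and bounded near 1, hence trivial by Poincare recurrence in T/L. Tiling T/L
   by small sets and counting their translates under Gamma h^-1 Gamma / Gamma
   then gives |Gamma h^-1 Gamma / Gamma| <= |Gamma h Gamma / Gamma|. *)

Require Import Defs.
From HB Require Import structures.
From mathcomp Require Import all_boot all_order all_algebra.
From mathcomp Require Import complex finmap.
From mathcomp Require Import all_classical all_reals all_analysis.
From mathcomp Require Import measurable_realfun.
From mathcomp Require Import ring lra.

Set Implicit Arguments.
Unset Strict Implicit.
Unset Printing Implicit Defensive.

Import Order.TTheory GRing.Theory Num.Theory.
Local Open Scope classical_set_scope.
Local Open Scope ring_scope.

(** * Counting cosets, and sums over cosets *)

Section CosetCounting.

Lemma card_fset_set_inj (I J : choiceType) (f : I -> J) (A : set I) (B : set J) :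
  finite_set A -> set_inj A f -> f @` A = B ->
  #|` fset_set B| = #|` fset_set A|.
Proof.
move=> finA injf <-; rewrite fset_set_image//.
rewrite card_in_imfset//= => x y.
by rewrite !in_fset_set// => xA yA; exact: injf.
Qed.

Lemma fsum_const (I : choiceType) (M : nmodType) (A : set I) (x : M) :
  finite_set A -> \sum_(i \in A) x = x *+ #|` fset_set A|.
Proof. by move=> finA; rewrite fsbig_finite// big_const_seq count_predT iter_addr_0. Qed.

(** Sum the common value [f i = f' j] over the related pairs: fixing [i] gives [n] terms, fixing [j]
    gives [m]. With values in any [nmodType] it serves for cardinals and for sums of vectors
    alike. *)
Lemma double_count (I J : choiceType) (M : nmodType) (A : set I) (B : set J)
    (r : I -> J -> Prop) (f : I -> M) (f' : J -> M) (m n : nat) :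
  finite_set A -> finite_set B ->
  (forall i j, A i -> B j -> r i j -> f i = f' j) ->
  (forall i, A i -> #|` fset_set (B `&` [set j | r i j])| = n) ->
  (forall j, B j -> #|` fset_set (A `&` [set i | r i j])| = m) ->
  (\sum_(i \in A) f i) *+ n = (\sum_(j \in B) f' j) *+ m.
Proof.
move=> finA finB ff' hn hm.
have -> : (\sum_(i \in A) f i) *+ n =
    \sum_(i \in A) \sum_(j \in B) (if `[< r i j >] then f i else 0).
  rewrite fsbig_finite// -sumrMnl fsbig_finite//.
  apply: eq_big_seq => i; rewrite in_fset_set// inE => Ai.
  rewrite -(hn i Ai) -fsum_const; last exact: finite_setIl.
  rewrite fsbig_mkcondr; apply: eq_fsbigr => j _.
  by congr (if _ then _ else _); apply/asboolP/idP; rewrite inE.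
rewrite exchange_fsbig// [RHS](_ : _ =
    \sum_(j \in B) \sum_(i \in A) (if `[< r i j >] then f' j else 0)).
  apply: eq_fsbigr => j; rewrite inE => Bj.
  apply: eq_fsbigr => i; rewrite inE => Ai.
  by case: asboolP => // /ff' ->.
rewrite fsbig_finite// -sumrMnl fsbig_finite//.
apply: eq_big_seq => j; rewrite in_fset_set// inE => Bj.
rewrite -(hm j Bj) -fsum_const; last exact: finite_setIl.
rewrite fsbig_mkcondr; apply: eq_fsbigr => i _.
by congr (if _ then _ else _); apply/asboolP/idP; rewrite inE.
Qed.

Variable G : groupType.
Implicit Types (A B S H X : set G) (g h x y : G) (c : set G).

(** [X] is a union of left cosets of [S], so the representative [xget 1%g c] of a coset [c] in
    [lcosets X S] lies in [X] again. *)
Definition rinv X S := forall x s, X x -> S s -> X (x * s)%g.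

Lemma rinv_dcoset H S g : is_subgroup H -> S `<=` H -> rinv (dcoset H g) S.
Proof.
move=> [_ HM _] SH _ s [a Ha [b Hb <-]] Ss.
exists a => //; exists (b * s)%g; last by rewrite mulgA.
by apply: HM => //; exact: SH.
Qed.

Lemma lcoset_refl S x : is_subgroup S -> lcoset x S x.
Proof. by move=> [S1 _ _]; exists 1%g => //; rewrite mulg1. Qed.

Lemma mem_lcoset S x y : is_subgroup S -> lcoset x S y -> lcoset y S = lcoset x S.
Proof. by move=> sS [s Ss <-]; apply/lcoset_eqP => //; rewrite mulKg. Qed.

Lemma coset_rep_mem S X c : is_subgroup S -> lcosets X S c -> c (xget 1%g c).
Proof.
move=> sS [x _ <-]; case: xgetP => [y _ //|/(_ x)[]].
exact: lcoset_refl.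
Qed.

Lemma coset_repK S X c : is_subgroup S -> lcosets X S c ->
  lcoset (xget 1%g c) S = c.
Proof.
move=> sS hc; have := coset_rep_mem sS hc; case: hc => x _ <-.
exact: mem_lcoset.
Qed.

Lemma coset_rep_in S X c : is_subgroup S -> rinv X S -> lcosets X S c ->
  X (xget 1%g c).
Proof.
move=> sS iX hc; have := coset_rep_mem sS hc; case: hc => x Xx <-.
by case=> s Ss <-; exact: iX.
Qed.

Lemma ncosets_lmul x A S : finite_set (lcosets A S) ->
  ncosets [set (x * a)%g | a in A] S = ncosets A S.
Proof.
move=> finA; apply: (@card_fset_set_inj _ _ (fun c => [set (x * a)%g | a in c])) => //.
  move=> c d _ _ e; apply/seteqP.
  suff sub c1 d1 : [set (x * a)%g | a in c1] = [set (x * a)%g | a in d1] -> c1 `<=` d1.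
    by split; apply: sub.
  move=> {}e y cy; have : [set (x * a)%g | a in c1] (x * y)%g by exists y.
  by rewrite e => -[z dz /mulgI <-].
have E a : [set (x * y)%g | y in lcoset a S] = lcoset (x * a)%g S.
  apply/seteqP; split=> [_ [_ [s Ss <-] <-]|_ [s Ss <-]].
    by exists s => //; rewrite mulgA.
  by exists (a * s)%g; [exists s|rewrite mulgA].
apply/seteqP; split=> [_ [_ [a Aa <-] <-]|_ [_ [a Aa <-] <-]].
  by exists (x * a)%g; [exists a|rewrite E].
by exists (lcoset a S); [exists a|rewrite E].
Qed.

(** As [b] normalises [S], [a S b = a b S]: right multiplication by [b] carries left cosets to left
    cosets. *)
Lemma ncosets_rmul b A S : is_subgroup S ->
  (forall s, S s <-> S (b * s * b^-1)%g) -> finite_set (lcosets A S) ->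
  ncosets [set (a * b)%g | a in A] S = ncosets A S.
Proof.
move=> sS nb finA.
apply: (@card_fset_set_inj _ _ (fun c => [set (a * b)%g | a in c])) => //.
  move=> c d _ _ e; apply/seteqP.
  suff sub c1 d1 : [set (a * b)%g | a in c1] = [set (a * b)%g | a in d1] -> c1 `<=` d1.
    by split; apply: sub.
  move=> {}e y cy; have : [set (a * b)%g | a in c1] (y * b)%g by exists y.
  by rewrite e => -[z dz /mulIg <-].
have E a : [set (y * b)%g | y in lcoset a S] = lcoset (a * b)%g S.
  apply/seteqP; split=> [_ [_ [s Ss <-] <-]|_ [s Ss <-]].
    exists (b^-1 * s * b)%g; last by rewrite !mulgA mulgK.
    by apply/nb; rewrite !mulgA mulgV mul1g mulgK.
  exists (a * (b * s * b^-1))%g; first by exists (b * s * b^-1)%g => //; apply: (nb s).1.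
  by rewrite !mulgA mulgVK.
apply/seteqP; split=> [_ [_ [a Aa <-] <-]|_ [_ [a Aa <-] <-]].
  by exists (a * b)%g; [exists a|rewrite E].
by exists (lcoset a S); [exists a|rewrite E].
Qed.

(** Each coset [x S] in [X] splits into [ncosets S S'] cosets of [S'], and [e] takes the same value
    on all of them. *)
Lemma coset_sum_refine (M : nmodType) (e : G -> M) X S S' :
  is_subgroup S -> is_subgroup S' -> S' `<=` S -> rinv X S ->
  finite_set (lcosets X S) -> finite_set (lcosets X S') ->
  finite_set (lcosets S S') ->
  (forall x s, X x -> S s -> e (x * s)%g = e x) ->
  \sum_(c \in lcosets X S') e (xget 1%g c) =
  (\sum_(c \in lcosets X S) e (xget 1%g c)) *+ ncosets S S'.
Proof.
move=> sS sS' SS iX finX finX' finS eS.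
have iX' : rinv X S' by move=> x s Xx /SS; exact: iX.
rewrite -[LHS]mulr1n.
apply: (@double_count _ _ _ _ _ (fun c' c => c = lcoset (xget 1%g c') S)) => //.
- move=> c' c hc' hc e'; have Xc' := coset_rep_in sS' iX' hc'.
  have := coset_rep_mem sS hc; rewrite {1}e' => -[s Ss <-].
  by rewrite eS.
- move=> c' hc'; rewrite (_ : _ `&` _ = [set lcoset (xget 1%g c') S]).
    by rewrite fset_set1 cardfs1.
  apply/seteqP; split=> [c []//|_ ->]; split=> //.
  by exists (xget 1%g c') => //; exact: coset_rep_in hc'.
- move=> c hc; set x := xget 1%g c.
  have Xx : X x by exact: coset_rep_in hc.
  rewrite -(@ncosets_lmul x)//; congr (#|` fset_set _|).
  apply/seteqP; split.
    move=> c' [hc' /= e']; have := coset_rep_mem sS hc; rewrite -/x e'.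
    case=> s Ss ex; exists (xget 1%g c'); last exact: coset_repK hc'.
    exists s^-1%g; first by case: sS => _ _; exact.
    by rewrite -ex mulgK.
  move=> _ [_ [s Ss <-] <-].
  have h : lcosets X S' (lcoset (x * s)%g S') by exists (x * s)%g => //; exact: iX.
  split=> //=; rewrite -(coset_repK sS hc) -/x.
  have := coset_rep_mem sS' h => -[s' Ss' <-].
  apply/lcoset_eqP => //; rewrite -mulgA invgM mulgVK.
  by case: sS => _ SM SV; apply/SV/SM => //; exact: SS.
Qed.

(** For [x = a g b] with [a], [b] in [H], which normalise [S], one has [S x S = a (S g S) b]. *)
Lemma ncosets_dcoset_const H S g x : is_subgroup H -> is_normal_in S H ->
  finite_set (lcosets (dcoset S g) S) -> dcoset H g x ->
  ncosets (dcoset S x) S = ncosets (dcoset S g) S.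
Proof.
move=> sH [sS SH nS] fin [a Ha [b Hb <-]].
have [_ HM HV] := sH.
have nC h : H h -> forall s, S s <-> S (h * s * h^-1)%g.
  move=> Hh s; split=> [|Sh]; first exact: nS.
  have := nS _ _ (HV _ Hh) Sh.
  by rewrite invgK !mulgA mulVg mul1g mulgVK.
have -> : dcoset S (a * g * b)%g =
    [set (a * y)%g | y in [set (z * b)%g | z in dcoset S g]].
  apply/seteqP; split.
    move=> _ [s Ss [t St <-]].
    exists ((a^-1 * s * a) * g * (b * t * b^-1) * b)%g.
      exists ((a^-1 * s * a) * g * (b * t * b^-1))%g => //.
      exists (a^-1 * s * a)%g.
        by have /nC := HV _ Ha; move=> /(_ s)[+ _]; rewrite invgK => /(_ Ss).
      by exists (b * t * b^-1)%g => //; exact: (nC _ Hb t).1.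
    by rewrite !mulgA mulgV mul1g !mulgVK.
  move=> _ [_ [_ [s Ss [t St <-]] <-] <-].
  exists (a * s * a^-1)%g; first exact: (nC _ Ha s).1.
  exists (b^-1 * t * b)%g.
    by have /nC := HV _ Hb; move=> /(_ t)[+ _]; rewrite invgK => /(_ St).
  by rewrite !mulgA !mulgVK mulgK.
have finb : finite_set (lcosets [set (z * b)%g | z in dcoset S g] S).
  apply: sub_finite_set (finite_image (fun c => [set (z * b)%g | z in c]) fin).
  move=> _ [_ [z hz <-] <-]; exists (lcoset z S); first by exists z.
  apply/seteqP; split=> [_ [_ [s Ss <-] <-]|_ [s Ss <-]].
    exists (b^-1 * s * b)%g; last by rewrite !mulgA mulgK.
    by have /nC := HV _ Hb; move=> /(_ s)[+ _]; rewrite invgK => /(_ Ss).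
  exists (z * (b * s * b^-1))%g; first by exists (b * s * b^-1)%g => //; exact: (nC _ Hb s).1.
  by rewrite !mulgA mulgVK.
rewrite ncosets_lmul// ncosets_rmul//; exact: nC.
Qed.

Lemma dcosetV H g x : is_subgroup H -> dcoset H g x -> dcoset H g^-1%g x^-1%g.
Proof.
move=> [_ _ HV] [a Ha [b Hb <-]]; exists b^-1%g; first exact: HV.
by exists a^-1%g; [exact: HV|rewrite !invgM mulgA].
Qed.

Lemma dcoset_sub H S g x : is_subgroup H -> S `<=` H -> dcoset H g x ->
  dcoset S x `<=` dcoset H g.
Proof.
move=> [_ HM _] SH [a Ha [b Hb <-]] _ [s /SH Hs [t /SH Ht <-]].
by exists (s * a)%g; [exact: HM|exists (b * t)%g; [exact: HM|rewrite !mulgA]].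
Qed.

Lemma dcoset_refl H g : is_subgroup H -> dcoset H g g.
Proof. by move=> [H1 _ _]; exists 1%g => //; exists 1%g => //; rewrite mul1g mulg1. Qed.

Lemma lcosets_sub A B S : A `<=` B -> lcosets A S `<=` lcosets B S.
Proof. by move=> AB _ [a /AB Ba <-]; exists a. Qed.

(* Counts the pairs of cosets (x S, y S) with y in S x^-1 S; by normality
   |S x S / S| does not depend on x in H g H. *)
Lemma coset_sum_inv (M : nmodType) (F : G -> M) H S g :
  is_subgroup H -> is_normal_in S H ->
  finite_set (lcosets (dcoset H g) S) ->
  finite_set (lcosets (dcoset H g^-1%g) S) ->
  (forall x s t, dcoset H g x -> S s -> S t -> F (s * x * t)%g = F x) ->
  (\sum_(c \in lcosets (dcoset H g) S) F (xget 1%g c))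
    *+ ncosets (dcoset S g^-1%g) S =
  (\sum_(c \in lcosets (dcoset H g^-1%g) S) F (xget 1%g c)^-1%g)
    *+ ncosets (dcoset S g) S.
Proof.
move=> sH nSH fin fin' FS; have [sS SH nS] := nSH; have [S1 SM SV] := sS.
have iX h := @rinv_dcoset H S h sH SH.
have sd x y : dcoset S x y -> dcoset S y x.
  move=> [s Ss [t St <-]]; exists s^-1%g; first exact: SV.
  by exists t^-1%g; [exact: SV|rewrite !mulgA mulVg mul1g mulgK].
have cnt h x : finite_set (lcosets (dcoset H h) S) -> dcoset H h x ->
    #|` fset_set (lcosets (dcoset H h) S `&`
      [set c | dcoset S x (xget 1%g c)])| = ncosets (dcoset S h) S.
  move=> finh hx; rewrite -(ncosets_dcoset_const sH nSH _ hx); last first.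
    apply: sub_finite_set finh; apply: lcosets_sub; apply: dcoset_sub => //.
    exact: dcoset_refl.
  congr (#|` fset_set _|); apply/seteqP; split.
    move=> c [hc /= xc]; exists (xget 1%g c) => //; exact: coset_repK hc.
  move=> _ [y xy <-]; have hy : dcoset H h y by exact: dcoset_sub hx _ xy.
  have hc : lcosets (dcoset H h) S (lcoset y S) by exists y.
  split=> //=; have := coset_rep_mem sS hc => -[s Ss <-].
  exact: rinv_dcoset xy Ss.
apply: (@double_count _ _ _ _ _ (fun c c' =>
  dcoset S (xget 1%g c)^-1%g (xget 1%g c'))) => //.
- move=> c c' hc hc' /(dcosetV sS); rewrite invgK => -[s Ss [t St <-]].
  by rewrite FS//; exact: coset_rep_in hc.
- move=> c hc; apply: cnt => //; apply: dcosetV => //.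
  exact: coset_rep_in hc.
- move=> c' hc'.
  have h : dcoset H g (xget 1%g c')^-1%g.
    by rewrite -[g]invgK; apply: dcosetV => //; exact: coset_rep_in hc'.
  rewrite -(cnt _ _ fin h); congr (#|` fset_set (_ `&` _)|).
  apply/seteqP; split=> c /=.
    by move=> /sd/(dcosetV sS); rewrite invgK.
  by move=> /(dcosetV sS)/sd; rewrite invgK.
Qed.

Lemma ncosets_gt0 A S x : finite_set (lcosets A S) -> A x -> (0 < ncosets A S)%N.
Proof.
move=> fin Ax; rewrite /ncosets cardfs_gt0; apply/fset0Pn.
by exists (lcoset x S); rewrite in_fset_set// inE; exists x.
Qed.

End CosetCounting.

(** * Finite index of congruence subgroups, and the modular ratio *)

Section FiniteIndex.
Variable G : groupType.
Implicit Types (A B S H X : set G) (g h x y : G) (c : set G).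

Lemma finite_lcosetsI H A B : finite_set (lcosets H A) ->
  finite_set (lcosets H B) -> finite_set (lcosets H (A `&` B)).
Proof.
move=> fA fB.
apply: sub_finite_set (finite_image (fun p => p.1 `&` p.2) (finite_setX fA fB)).
move=> _ [x Hx <-]; exists (lcoset x A, lcoset x B).
  by split; exists x.
apply/seteqP; split=> [_ [[a Aa <-] [b Bb /mulgI e]]|_ [a [Aa Ba] <-]].
  by exists a => //; split=> //; rewrite -e.
by split; exists a.
Qed.

Lemma finite_lcosets_trans X S S' : is_subgroup S -> is_subgroup S' ->
  finite_set (lcosets X S) -> finite_set (lcosets S S') ->
  finite_set (lcosets X S').
Proof.
move=> sS sS' fX fS.
apply: sub_finite_set (finite_image
  (fun p => [set (xget 1%g p.1 * y)%g | y in p.2]) (finite_setX fX fS)).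
move=> _ [x Xx <-].
have hc : lcosets X S (lcoset x S) by exists x.
have [s Ss es] := coset_rep_mem sS hc.
exists (lcoset x S, lcoset s^-1%g S').
  by split=> //; exists s^-1%g => //; case: sS => _ _; exact.
rewrite /= -es; apply/seteqP; split=> [_ [_ [t St <-] <-]|_ [t St <-]].
  by exists t => //; rewrite mulgA mulgK.
by exists (s^-1 * t)%g; [exists t|rewrite mulgA mulgK].
Qed.

(** Orbit and stabiliser: [x h S = y h S] for [x], [y] in [H] exactly when they lie in one coset of
    the stabiliser, the part of [h S h^-1] in [H]. *)
Lemma finite_lcosets_stab H S h : is_subgroup H -> is_subgroup S ->
  finite_set (lcosets [set (x * h)%g | x in H] S) ->
  finite_set (lcosets H [set x | H x /\ S (h^-1 * x * h)%g]).
Proof.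
move=> [_ HM HV] sS fin.
apply: sub_finite_set (finite_image
  (fun c => [set y | H y /\ lcoset (y * h)%g S = c]) fin).
move=> _ [x Hx <-]; exists (lcoset (x * h)%g S).
  by exists (x * h)%g => //; exists x.
apply/seteqP; split=> [y [Hy /lcoset_eqP-/(_ sS)]|_ [y [Hy hy] <-]].
  rewrite invgM -!mulgA !(mulgA _ _ h) => hy; exists (x^-1 * y)%g; last exact: mulVKg.
  by split; [apply: HM => //; exact: HV|rewrite !mulgA in hy *].
split; first exact: HM.
by apply/lcoset_eqP => //; rewrite invgM -!mulgA mulKg mulgA.
Qed.

(** The condition on [h] in [hker] depends only on the coset [h S], so representatives of the
    finitely many cosets suffice: [hker H S g] is the intersection of [S] with finitely many
    stabilisers of finite index. *)
Lemma finite_lcosets_hker H S g : is_subgroup H -> is_normal_in S H ->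
  finite_set (lcosets H S) -> finite_set (lcosets (dcoset H g) S) ->
  finite_set (lcosets H (hker H S g)).
Proof.
move=> sH [sS SH nS] fS fg; have [_ SM SV] := sS.
pose St (hs : seq G) := [set x | S x /\ forall h, h \in hs -> S (h^-1 * x * h)%g].
have fSt hs : (forall h, h \in hs -> dcoset H g h) -> finite_set (lcosets H (St hs)).
  elim: hs => [_|h hs IH hhs].
    rewrite (_ : St [::] = S)//.
    by apply/seteqP; split=> [x []|x Sx]//; split.
  have -> : St (h :: hs) = St hs `&` [set x | H x /\ S (h^-1 * x * h)%g].
    apply/seteqP; split=> [x [Sx hx]|x [[Sx hx] [_ Hx]]].
      split; first by split=> // k kin; apply: hx; rewrite inE kin orbT.
      by split; [exact: SH|apply: hx; rewrite inE eqxx].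
    by split=> // k; rewrite inE => /predU1P[->//|]; exact: hx.
  apply: finite_lcosetsI.
    by apply: IH => k kin; apply: hhs; rewrite inE kin orbT.
  apply: finite_lcosets_stab => //; apply: sub_finite_set fg; apply: lcosets_sub.
  by move=> _ [x Hx <-]; apply: dcosetMl => //; apply: hhs; rewrite inE eqxx.
have iX := @rinv_dcoset _ H S g sH SH.
pose hs := [seq xget 1%g c | c <- fset_set (lcosets (dcoset H g) S)].
have -> : hker H S g = St hs.
  apply/seteqP; split=> [x /hkerP-/(_ sS)[Sx hx]|x [Sx hx]].
    split=> // h /mapP[c]; rewrite in_fset_set// inE => hc ->.
    by apply: hx; exact: coset_rep_in hc.
  apply/hkerP => //; split=> // h hg.
  have hc : lcosets (dcoset H g) S (lcoset h S) by exists h.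
  have [s Ss es] := coset_rep_mem sS hc.
  have : S ((h * s)^-1 * x * (h * s))%g.
    rewrite es; apply: hx; apply/mapP; exists (lcoset h S) => //.
    by rewrite in_fset_set// inE.
  move=> Sx'; have -> : (h^-1 * x * h = s * ((h * s)^-1 * x * (h * s)) * s^-1)%g.
    by rewrite invgM !mulgA mulgV mul1g mulgK.
  exact: SM _ _ (SM _ _ Ss Sx') (SV _ Ss).
apply: fSt => h /mapP[c]; rewrite in_fset_set// inE => hc ->.
exact: coset_rep_in hc.
Qed.

Lemma finite_lcosets_sup H A B : is_subgroup A -> is_subgroup B -> A `<=` B ->
  finite_set (lcosets H A) -> finite_set (lcosets H B).
Proof.
move=> sA sB AB fA.
apply: sub_finite_set (finite_image (fun c => lcoset (xget 1%g c) B) fA).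
move=> _ [x Hx <-]; have hc : lcosets H A (lcoset x A) by exists x.
exists (lcoset x A) => //; have [a Aa <-] := coset_rep_mem sA hc.
by apply: mem_lcoset => //; exists a => //; exact: AB.
Qed.

Variable Gam : subgroup G.
Hypothesis hecke : hecke_pair Gam.

(** Induction on the iterated kernels: the Hecke condition and the finite index of the previous
    kernel make the quotient of [dcoset Gam g] by that kernel finite, as [finite_lcosets_hker]
    requires. *)
Lemma congruence_finite_index S : congruence Gam S -> finite_set (lcosets Gam S).
Proof.
have sH := subgroupP Gam.
move=> [sS SH [gs hgs]]; apply: finite_lcosets_sup hgs _ => //.
  by have [] := iter_hker_normal gs sH (is_normal_refl sH).
elim/last_ind: gs => [|gs g IH].
  apply: sub_finite_set (finite_set1 (lcoset 1%g Gam)) => _ [x Gx <-].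
  by apply/lcoset_eqP => //; rewrite invg1 mul1g.
rewrite foldl_rcons; have nG := iter_hker_normal gs sH (is_normal_refl sH).
apply: finite_lcosets_hker => //; apply: finite_lcosets_trans (hecke g) IH => //.
by case: nG.
Qed.

Lemma congruence_finite_dcoset S g : congruence Gam S ->
  finite_set (lcosets (dcoset Gam g) S).
Proof.
move=> cS; apply: finite_lcosets_trans (hecke g) (congruence_finite_index cS).
  exact: subgroupP.
by case: cS.
Qed.

Lemma congruence_finite_index_sub S S' : congruence Gam S -> congruence Gam S' ->
  finite_set (lcosets S S').
Proof.
move=> [_ SG _] /congruence_finite_index; apply: sub_finite_set.
exact: lcosets_sub.
Qed.

Lemma congruence_finite_self S g : congruence Gam S ->
  finite_set (lcosets (dcoset S g) S).
Proof.
move=> cS; have := congruence_finite_dcoset g cS.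
apply: sub_finite_set; apply: lcosets_sub.
have [_ SG _] := cS; have sG := subgroupP Gam.
by apply: dcoset_sub => //; exact: dcoset_refl.
Qed.

(** Count [S g S] and [S g^-1 S] by cosets of the smaller [S']. The case of a constant function in
    [coset_sum_inv], with [S] in the role of [H], relates the two counts by the ratio of [S']; the
    factor [ncosets S S'] cancels. *)
Lemma modular_ratio_sub (K : numFieldType) S S' g :
  congruence Gam S -> normal_congruence Gam S' -> S' `<=` S ->
  (ncosets (dcoset S g) S)%:R / (ncosets (dcoset S g^-1%g) S)%:R =
  (ncosets (dcoset S' g) S')%:R / (ncosets (dcoset S' g^-1%g) S')%:R :> K.
Proof.
move=> cS [cS' [sS' _ nS']] SS.
have [sS SG _] := cS.
have fd h : finite_set (lcosets (dcoset S h) S').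
  apply: finite_lcosets_trans (congruence_finite_self h cS) _ => //.
  exact: congruence_finite_index_sub.
have nSS : is_normal_in S' S by split=> // x s /SG; exact: nS'.
have n0 T h : congruence Gam T -> (ncosets (dcoset T h) T)%:R != 0 :> K.
  move=> cT; rewrite pnatr_eq0 -lt0n.
  apply: ncosets_gt0 (congruence_finite_self h cT) (dcoset_refl _ _).
  by case: cT.
have ref h : (ncosets (dcoset S h) S')%N =
    (ncosets (dcoset S h) S * ncosets S S')%N.
  have := @coset_sum_refine G nat (fun=> 1%N) (dcoset S h) S S' sS sS' SS
    (rinv_dcoset (g:=h) sS (@subset_refl _ S)) (congruence_finite_self h cS) (fd h)
    (congruence_finite_index_sub cS cS') (fun _ _ _ _ => erefl).
  have E c (T : set G) : finite_set (lcosets c T) ->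
      \sum_(d \in lcosets c T) 1%N = ncosets c T :> nat.
    by move=> fc; rewrite fsum_const// -[LHS]/(_%:R) natn.
  by rewrite !E//; [rewrite -mulr_natr natn|exact: congruence_finite_self].
have := @coset_sum_inv G K (fun=> 1) S S' g sS nSS (fd g) (fd _) (fun _ _ _ _ _ _ => erefl).
rewrite !fsum_const// -/(ncosets _ _) -/(ncosets _ _) !ref -!mulrnA => /eqP.
have nS0 : (ncosets S S' != 0)%N.
  rewrite -lt0n; have [S1 _ _] := sS.
  exact: ncosets_gt0 (congruence_finite_index_sub cS cS') S1.
move=> e; apply/eqP; rewrite eqr_div ?n0// -!natrM.
move: e; rewrite !eqr_nat.
rewrite ![(_ * ncosets S S')%N]mulnC -!mulnA eqn_pmul2l ?lt0n// => /eqP->.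
by rewrite mulnC.
Qed.

End FiniteIndex.

(** * Hecke operators as averages at a common level *)

Section HeckeOperator.
Variables (R : realType) (G : groupType) (V : gmodType R[i] G).
Variable Gam : subgroup G.
Hypothesis hecke : hecke_pair Gam.
Variable q : nat.
Implicit Types (S J : ncong Gam) (g h x y : G) (v w : V).

Lemma ncong_congruence S : congruence Gam S.
Proof. by have [] := ncongP S. Qed.

Lemma ncong_subgroup S : is_subgroup S.
Proof. by have [] := ncong_congruence S. Qed.

Lemma ncong_sub S : S `<=` Gam.
Proof. by have [] := ncong_congruence S. Qed.

Lemma ncong_rinv S g : rinv (dcoset Gam g) S.
Proof. exact: rinv_dcoset (subgroupP Gam) (@ncong_sub S). Qed.

Let sub_conj S (J : set G) g x : J `<=` hker Gam S g -> dcoset Gam g x ->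
  J `<=` conjset x S.
Proof. by move=> JS hx s /JS; apply: hker_conj hx _; exact: ncongP. Qed.

Lemma Hcls_eq (A : set G) v w : v \in H0 V A q -> w \in H0 V A q ->
  (Hcls q A v == Hcls q A w) = (v - w \in H0prev V A q).
Proof. exact: eq_cls. Qed.

Lemma Hcls_sum (A : set G) (I : choiceType) (P : set I) (f : I -> V) :
  finite_set P -> (forall i, P i -> f i \in H0 V A q) ->
  Hcls q A (\sum_(i \in P) f i) = \sum_(i \in P) Hcls q A (f i).
Proof.
move=> fP fA; rewrite !fsbig_finite//.
have {}fA i : i \in enum_fset (fset_set P) -> f i \in H0 V A q.
  by move=> iP; apply: fA; have := in_fset_set fP i; rewrite iP => /esym/set_mem.
elim: (enum_fset _) fA => [|i s IH] fA.
  rewrite !big_nil; apply/(addrI (Hcls q A 0)).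
  by rewrite -[LHS]clsD ?rpred0// !addr0.
rewrite !big_cons -IH; last by move=> j js; apply: fA; rewrite in_cons js orbT.
rewrite -[RHS]clsD//; first by apply: fA; rewrite mem_head.
by rewrite big_seq rpred_sum// => j js; apply: fA; rewrite in_cons js orbT.
Qed.

(** The operator at level [S], read off a representative [v] in the module of a level [J] that may
    be shrunk freely inside [hker Gam S g]; averages formed at different [S] can then be compared in
    one module. *)
Definition hecke_avg (S J : set G) g v : Hbar V q J :=
  (ncosets Gam S)%:R^-1 *:
    \sum_(c \in lcosets (dcoset Gam g) S) Hcls q J (gact (xget 1%g c) v).

Lemma gact_H0 S (J : set G) g x v : J `<=` hker Gam S g -> dcoset Gam g x ->
  v \in H0 V S q -> gact x v \in H0 V J q.
Proof. by move=> JS hx; apply: H0_gact; exact: sub_conj hx. Qed.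

Lemma Hcls_gact_eq S (J : set G) g x v w : J `<=` hker Gam S g -> dcoset Gam g x ->
  v \in H0 V S q -> w \in H0 V S q -> Hcls q S v = Hcls q S w ->
  Hcls q J (gact x v) = Hcls q J (gact x w).
Proof.
move=> JS hx vS wS /eqP; rewrite Hcls_eq// => vw; apply/eqP.
rewrite Hcls_eq ?(gact_H0 JS hx)// -scaleN1r -gactZ -gactD scaleN1r.
by apply: H0prev_gact vw; exact: sub_conj hx.
Qed.

(** [s v - v] lies one step lower in the augmentation filtration ([H0_gact_sub]), so the class of
    [x v] depends only on the coset [x S]. *)
Lemma Hcls_gactM S (J : set G) g x s v : J `<=` hker Gam S g ->
  dcoset Gam g x -> (S : set G) s -> v \in H0 V S q ->
  Hcls q J (gact (x * s)%g v) = Hcls q J (gact x v).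
Proof.
move=> JS hx Ss vS; rewrite gactM; have [S1 _ SV] := ncong_subgroup S.
have sv : gact s v \in H0 V S q.
  apply: (H0_gact _ vS) => t St; have [_ SM _] := ncong_subgroup S.
  exists (s^-1 * t * s)%g; first by apply: (SM _ _ (SM _ _ (SV _ Ss) St) Ss).
  by rewrite !mulgA mulgV mul1g mulgK.
apply: (Hcls_gact_eq JS hx sv vS); apply/eqP; rewrite Hcls_eq//.
exact: H0_gact_sub.
Qed.

Lemma hecke_map_avg S (J : set G) g v : J `<=` hker Gam S g -> v \in H0 V S q ->
  Hres J (hecke_map Gam g (Hcls q S v)) = hecke_avg S J g v.
Proof.
move=> JS vS; have fin := congruence_finite_dcoset hecke g (ncong_congruence S).
have sS := ncong_subgroup S.
rewrite (@hecke_mapE _ _ _ _ _ _ _ (ncongP S) fin (xget 1%g)) //; last first.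
  by move=> c; exact: coset_rep_mem.
have hin (K : set G) c : K `<=` hker Gam S g -> lcosets (dcoset Gam g) S c ->
    gact (xget 1%g c) v \in H0 V K q.
  move=> KS hc; apply: (gact_H0 KS _ vS).
  exact: (coset_rep_in sS (@ncong_rinv S g) hc).
have sin (K : set G) : K `<=` hker Gam S g ->
    \sum_(c \in lcosets (dcoset Gam g) S) gact (xget 1%g c) v \in H0 V K q.
  move=> KS; rewrite fsbig_finite// big_seq rpred_sum// => c.
  by rewrite in_fset_set// inE => hc; exact: hin.
rewrite HresE//; last by rewrite rpredZ// sin.
rewrite /Hcls clsZ ?sin//; congr (_ *: _).
by apply: Hcls_sum => // c hc; exact: hin.
Qed.

(** Passing to [S'] repeats every term [ncosets S S'] times and multiplies the index in [Gam] by the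
    same number. *)
Lemma hecke_avg_refine (S S' : ncong Gam) (J : set G) g v : S' `<=` S ->
  J `<=` hker Gam S' g -> v \in H0 V S q ->
  hecke_avg S' J g v = hecke_avg S J g v.
Proof.
move=> SS JS vS.
have [cS cS'] := (ncong_congruence S, ncong_congruence S').
have [sS sS'] := (ncong_subgroup S, ncong_subgroup S').
have JS' : J `<=` hker Gam S g.
  by apply: subset_trans JS _; exact: hker_mono.
have fI := congruence_finite_index_sub hecke cS cS'.
rewrite /hecke_avg (coset_sum_refine (S := S) (e := fun x => Hcls q J (gact x v))) //.
- have -> : ncosets Gam S' = (ncosets Gam S * ncosets S S')%N.
    have := @coset_sum_refine G nat (fun=> 1%N) Gam S S' sS sS' SS.
    have iG : rinv Gam S.
      by move=> x s Gx /ncong_sub Gs; have [_ GM _] := subgroupP Gam; exact: GM.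
    move=> /(_ iG (congruence_finite_index hecke cS)
      (congruence_finite_index hecke cS') fI (fun _ _ _ _ => erefl)).
    rewrite !fsum_const; try exact: congruence_finite_index.
    by rewrite -/(ncosets _ _) -/(ncosets _ _) -mulrnA -!/(_%:R) !natn.
  rewrite -[X in _ *: X = _]scaler_nat scalerA; congr (_ *: _).
  have n0 : (ncosets S S')%:R != 0 :> R[i].
    rewrite pnatr_eq0 -lt0n; apply: (ncosets_gt0 fI (x := 1%g)).
    by case: sS.
  by rewrite natrM invfM -mulrA mulVf// mulr1.
- exact: ncong_rinv.
- exact: congruence_finite_dcoset.
- exact: congruence_finite_dcoset.
- by move=> x s hx Ss; exact: (Hcls_gactM JS').
Qed.

Lemma hecke_avg_eq S (J : set G) g v w : J `<=` hker Gam S g ->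
  v \in H0 V S q -> w \in H0 V S q -> Hcls q S v = Hcls q S w ->
  hecke_avg S J g v = hecke_avg S J g w.
Proof.
move=> JS vS wS e; congr (_ *: _); apply: eq_fsbigr => c; rewrite inE => hc.
apply: (Hcls_gact_eq JS) => //.
exact: (coset_rep_in (ncong_subgroup S) (@ncong_rinv S g) hc).
Qed.

Lemma Hcls_rep S (x : Hbar V q S) : exists2 v, v \in H0 V S q & x = Hcls q S v.
Proof. by exists (sq_rep x); [exact: sq_rep_in|rewrite [RHS]cls_rep]. Qed.

Lemma Lin_res S J (x : Hbar V q S) : J `<=` S -> Lin (Hres J x) = Lin x.
Proof. by move=> JS; exact: (@dl_in_map _ (hecke_sys V Gam q) S J x JS). Qed.

Lemma Lin_hecke_avg S J J' g v : J `<=` hker Gam S g -> J' `<=` hker Gam S g ->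
  v \in H0 V S q ->
  Lin (S := J) (hecke_avg S J g v) = Lin (S := J') (hecke_avg S J' g v).
Proof.
move=> JS JS' vS.
have E (K : ncong Gam) (KS : K `<=` hker Gam S g) :
    Lin (S := K) (hecke_avg S K g v) =
    Lin (S := ncong_hker S g) (hecke_map Gam g (Hcls q S v)).
  by rewrite -hecke_map_avg//; exact: (@Lin_res (ncong_hker S g) K).
by rewrite !E.
Qed.

(** [hecke_op] is defined on the chosen representative of a class in the limit; here any level and
    vector representing it are allowed. The chosen level [S0] and [S] are both refined to [k], where
    the two classes agree. *)
Lemma hecke_op_cls S J g v : J `<=` hker Gam S g -> v \in H0 V S q ->
  hecke_op g (Lin (Hcls q S v)) = Lin (S := J) (hecke_avg S J g v).
Proof.
move=> JS vS; rewrite /hecke_op.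
have [k [S0k Sk ek]] := @dl_rep_eq _ (hecke_sys V Gam q) S (Hcls q S v).
move: S0k ek; rewrite -/(Lin _).
set S0 := dl_idx _; have [v0 v0S ->] := Hcls_rep (dl_rep (Lin (Hcls q S v))).
move=> S0k; rewrite [LHS](HresE S0k v0S) [RHS](HresE Sk vS) => ek.
have hs (T : ncong Gam) : k `<=` T -> hker Gam k g `<=` hker Gam T g.
  by apply: hker_mono; exact: ncong_subgroup.
transitivity (Lin (S := ncong_hker k g) (hecke_avg S0 (ncong_hker k g) g v0)).
  rewrite -hecke_map_avg//; last exact: hs.
  by apply/esym/(@Lin_res (ncong_hker S0 g) (ncong_hker k g)); exact: hs.
rewrite -(hecke_avg_refine S0k)// (hecke_avg_eq _ _ _ ek)//.
- by rewrite (hecke_avg_refine Sk)//; apply: Lin_hecke_avg => //; exact: hs.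
- exact: H0_mono v0S.
- exact: H0_mono vS.
Qed.

Lemma Lq_rep (x : Lq V Gam q) : exists S v, v \in H0 V S q /\ x = Lin (Hcls q S v).
Proof.
have [v vS e] := Hcls_rep (dl_rep x).
by exists (dl_idx x), v; rewrite -e; split=> //; rewrite [RHS]dl_rep_in.
Qed.

Lemma Lq_rep2 (x y : Lq V Gam q) : exists S v w,
  [/\ v \in H0 V S q, w \in H0 V S q, x = Lin (Hcls q S v) & y = Lin (Hcls q S w)].
Proof.
have [S [a [b [-> ->]]]] := @dl_lift2 _ (hecke_sys V Gam q) x y.
have [v vS ->] := Hcls_rep a; have [w wS ->] := Hcls_rep b.
by exists S, v, w.
Qed.

Lemma hecke_op_linear g : linear (@hecke_op _ _ V Gam q g).
Proof.
move=> k x y; have [S [v [w [vS wS -> ->]]]] := Lq_rep2 x y.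
have LinE J a b : Lin (S := J) (k *: a + b) = k *: Lin (q:=q) a + Lin b.
  by rewrite /Lin -dl_addE -dl_scaleE.
have JS : ncong_hker S g `<=` hker Gam S g by [].
rewrite -LinE -[k *: Hcls _ _ _]clsZ// -[_ + _]clsD ?rpredZ//.
rewrite !(hecke_op_cls JS) ?rpredD ?rpredZ// -LinE; congr Lin.
rewrite /hecke_avg scalerA mulrC -scalerA -scalerDr; congr (_ *: _).
have fin := congruence_finite_dcoset hecke g (ncong_congruence S).
rewrite !fsbig_finite// scaler_sumr -big_split; apply: eq_big_seq => c.
rewrite in_fset_set// inE => hc.
have hx : dcoset Gam g (xget 1%g c).
  exact: (coset_rep_in (ncong_subgroup S) (@ncong_rinv S g) hc).
by rewrite /= gact_is_linear /Hcls clsD ?clsZ// ?rpredZ ?(gact_H0 JS hx).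
Qed.

Lemma hecke_op_dcoset g h (x : Lq V Gam q) : dcoset Gam g = dcoset Gam h ->
  hecke_op g x = hecke_op h x.
Proof.
move=> e; have [S [v [vS ->]]] := Lq_rep x.
have eh : hker Gam S g = hker Gam S h by rewrite /hker e.
rewrite !(@hecke_op_cls S (ncong_hker S g))// /hecke_avg ?e//.
by rewrite -eh.
Qed.

End HeckeOperator.

(** * Inner products of finite sums *)

Section InnerProductSums.
Variables (R : realType) (M : lmodType R[i]) (ip : M -> M -> R[i]).
Hypothesis ipP : inner_product ip.
Implicit Types (x y z : M).

Lemma ip_linl y : linear_for *%R (ip^~ y). Proof. by case: ipP => + _ _; apply. Qed.

Lemma ipC x y : ip y x = (ip x y)^*%C. Proof. by case: ipP => _ + _; apply. Qed.

Lemma ipDl x y z : ip (x + y) z = ip x z + ip y z.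
Proof. by have := ip_linl z 1 x y; rewrite scale1r mul1r. Qed.

Lemma ip0l y : ip 0 y = 0.
Proof. by apply/(addrI (ip 0 y)); rewrite -ipDl !addr0. Qed.

Lemma ipZl k x y : ip (k *: x) y = k * ip x y.
Proof. by have := ip_linl y k x 0; rewrite !addr0 ip0l addr0. Qed.

Lemma ipDr x y z : ip z (x + y) = ip z x + ip z y.
Proof. by rewrite ipC ipDl raddfD /= -!ipC. Qed.

Lemma ip0r y : ip y 0 = 0.
Proof. by rewrite ipC ip0l rmorph0. Qed.

Lemma ipZr k x y : ip x (k *: y) = k^*%C * ip x y.
Proof. by rewrite ipC ipZl rmorphM /= -ipC. Qed.

Lemma ip_suml (I : Type) (s : seq I) (f : I -> M) y :
  ip (\sum_(i <- s) f i) y = \sum_(i <- s) ip (f i) y.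
Proof. exact: (big_morph (ip^~ y) (fun a b => ipDl a b y) (ip0l y)). Qed.

Lemma ip_sumr (I : Type) (s : seq I) (f : I -> M) y :
  ip y (\sum_(i <- s) f i) = \sum_(i <- s) ip y (f i).
Proof. exact: (big_morph (ip y) (fun a b => ipDr a b y) (ip0r y)). Qed.

Lemma ip_ge0 x : 0 <= ip x x.
Proof.
have [->|x0] := eqVneq x 0; first by rewrite ip0l.
by case: ipP => _ _ /(_ x x0)/ltW.
Qed.

(* Summing |f i - f j|^2 >= 0 over all pairs avoids the triangle inequality. *)
Lemma ip_sum_le (I : Type) (s : seq I) (f : I -> M) :
  ip (\sum_(i <- s) f i) (\sum_(i <- s) f i) <=
  (size s)%:R * \sum_(i <- s) ip (f i) (f i).
Proof.
set N := (size s)%:R; set T := ip _ _; set Q := \sum_(i <- s) _.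
have cs (c : R[i]) : \sum_(i <- s) c = N * c.
  by rewrite big_const_seq count_predT iter_addr_0 mulr_natl.
have TE : T = \sum_(i <- s) \sum_(j <- s) ip (f i) (f j).
  by rewrite /T ip_suml; apply: eq_bigr => i _; rewrite ip_sumr.
have : 0 <= \sum_(i <- s) \sum_(j <- s) ip (f i - f j) (f i - f j).
  by apply: sumr_ge0 => i _; apply: sumr_ge0 => j _; exact: ip_ge0.
have -> : \sum_(i <- s) \sum_(j <- s) ip (f i - f j) (f i - f j) =
    (N * Q - T) *+ 2.
  transitivity (\sum_(i <- s) (N * ip (f i) (f i) + Q
      - \sum_(j <- s) ip (f i) (f j) - \sum_(j <- s) ip (f j) (f i))).
    apply: eq_bigr => i _; rewrite -cs -big_split -!sumrB /=.
    apply: eq_bigr => j _.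
    rewrite ipDl !ipDr -scaleN1r !ipZl !ipZr rmorphN1 !mulN1r opprK.
    by ring.
  rewrite !sumrB big_split /= -mulr_sumr cs -TE exchange_big -TE -/Q.
  by ring.
by rewrite pmulrn_lge0// subr_ge0.
Qed.

End InnerProductSums.

(** * Adjoint and norm of the Hecke operators *)

Section UnitaryHecke.
Variables (R : realType) (G : groupType) (V : gmodType R[i] G).
Variable Gam : subgroup G.
Hypothesis hecke : hecke_pair Gam.
Variables (U : unitary_hecke_module V Gam) (q : nat).
Hypothesis q_gt0 : (0 < q)%N.
Implicit Types (S J : ncong Gam) (g h : G) (v w : V).

Let ipP (J : ncong Gam) : inner_product (@uhm_ip _ _ _ _ U q J).
Proof. by have [] := uhm_hilbert U q_gt0 (ncong_congruence J). Qed.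

Lemma uhm_ip_gact S (J : ncong Gam) x v w : J `<=` conjset x S ->
  v \in H0 V S q -> w \in H0 V S q ->
  uhm_ip U (Hcls q J (gact x v)) (Hcls q J (gact x w)) =
  uhm_ip U (Hcls q S v) (Hcls q S w).
Proof.
move=> JS vS wS; rewrite -!(HactE JS)//.
by apply: uhm_unitary => //; exact: ncong_congruence.
Qed.

Lemma uhm_ip_res S (J : ncong Gam) v w : J `<=` S ->
  v \in H0 V S q -> w \in H0 V S q ->
  uhm_ip U (Hcls q J v) (Hcls q J w) = uhm_ip U (Hcls q S v) (Hcls q S w).
Proof.
move=> JS vS wS; rewrite -!(HresE JS)//.
by apply: uhm_isometry => //; exact: ncong_congruence.
Qed.

(** Unitarity relates level [J] to levels inside [x J x^-1]. Apply [x] to the pair [v], [x^-1 w],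
    landing in [K], and return to [J] because restriction is an isometry. *)
Lemma uhm_ip_gactV J x v w : v \in H0 V J q -> w \in H0 V J q ->
  gact x v \in H0 V J q -> gact x^-1%g w \in H0 V J q ->
  uhm_ip U (Hcls q J (gact x v)) (Hcls q J w) =
  uhm_ip U (Hcls q J v) (Hcls q J (gact x^-1%g w)).
Proof.
move=> vJ wJ xvJ xwJ; pose K := ncong_hker J x.
have KJ : K `<=` conjset x J.
  by apply: hker_conj; [exact: ncongP|apply: dcoset_refl; exact: subgroupP].
rewrite -(uhm_ip_gact KJ vJ xwJ) -gactM mulgV gact1.
by rewrite (@uhm_ip_res J K)//; exact: hker_sub.
Qed.

Lemma Lip_hecke_op S J g v w : J `<=` S -> J `<=` hker Gam S g ->
  v \in H0 V S q -> w \in H0 V S q ->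
  Lip U (hecke_op g (Lin (Hcls q S v))) (Lin (Hcls q S w)) =
  (ncosets Gam S)%:R^-1 * \sum_(c \in lcosets (dcoset Gam g) S)
    uhm_ip U (Hcls q J (gact (xget 1%g c) v)) (Hcls q J w).
Proof.
move=> JS Jg vS wS; rewrite (hecke_op_cls hecke Jg)//.
rewrite -(Lin_res (Hcls q S w) JS) (HresE JS)// LipE// ipZl; last exact: ipP.
congr (_ * _); have fin := congruence_finite_dcoset hecke g (ncong_congruence S).
by rewrite !fsbig_finite// ip_suml//; exact: ipP.
Qed.

Lemma hecke_adjoint_ncong S g v w : v \in H0 V S q -> w \in H0 V S q ->
  Lip U (hecke_op g (Lin (Hcls q S v))) (Lin (Hcls q S w)) =
  (ncosets (dcoset S g) S)%:R / (ncosets (dcoset S g^-1%g) S)%:R *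
  Lip U (Lin (Hcls q S v)) (hecke_op g^-1%g (Lin (Hcls q S w))).
Proof.
move=> vS wS; pose J := ncongI (ncong_hker S g) (ncong_hker S g^-1%g).
have [Jg Jg'] : J `<=` hker Gam S g /\ J `<=` hker Gam S g^-1%g.
  by split=> x [].
have JS : J `<=` S by apply: subset_trans Jg _; exact: hker_sub.
have [vJ wJ] := (H0_mono JS vS, H0_mono JS wS).
have cS := ncong_congruence S; have sS := ncong_subgroup S.
have fin h := congruence_finite_dcoset hecke h cS.
(* Conjugate symmetry moves the operator to the first argument, where [Lip_hecke_op] applies; both
   sides become sums of inner products at level [J]. *)
rewrite [X in _ = _ * X](ipC (Lip_inner_product U q_gt0)).
rewrite !(@Lip_hecke_op S J)// rmorphM fmorphV rmorph_nat /=.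
pose F x := uhm_ip U (Hcls q J (gact x v)) (Hcls q J w).
have FV x : dcoset Gam g x ->
    F x = uhm_ip U (Hcls q J v) (Hcls q J (gact x^-1%g w)).
  move=> hx; apply: uhm_ip_gactV => //; first exact: (gact_H0 Jg hx).
  by apply: (gact_H0 Jg') => //; apply: dcosetV => //; exact: subgroupP.
have -> : (\sum_(c \in lcosets (dcoset Gam g^-1%g) S)
    uhm_ip U (Hcls q J (gact (xget 1%g c) w)) (Hcls q J v))^*%C =
    \sum_(c \in lcosets (dcoset Gam g^-1%g) S) F (xget 1%g c)^-1%g.
  rewrite !fsbig_finite// rmorph_sum; apply: eq_big_seq => c.
  rewrite in_fset_set// inE => hc /=; rewrite -(ipC (ipP J)).
  have hx := coset_rep_in sS (@ncong_rinv _ _ S _) hc.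
  rewrite FV ?invgK// -[g]invgK; apply: dcosetV => //; exact: subgroupP.
have sG := subgroupP Gam.
have n0 h : (ncosets (dcoset S h) S)%:R != 0 :> R[i].
  rewrite pnatr_eq0 -lt0n.
  exact: ncosets_gt0 (congruence_finite_self hecke h cS) (dcoset_refl h sS).
have [_ SM SV] := sS.
have := @coset_sum_inv G R[i] F Gam S g sG (ncongP S).2 (fin _) (fin _).
have SMl x s : dcoset Gam g x -> (S : set G) s -> dcoset Gam g (s * x)%g.
  by move=> hx Ss; apply: dcosetMl => //; exact: ncong_sub Ss.
(* Right invariance is [Hcls_gactM] for [v]; left invariance is the same fact for [w], since
   [(s x)^-1 = x^-1 s^-1]. *)
have H : forall x s t, dcoset Gam g x -> (S : set G) s -> (S : set G) t ->
    F (s * x * t)%g = F x.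
  move=> x s t hx Ss St; have hsx := SMl _ _ hx Ss.
  rewrite {1}/F (Hcls_gactM Jg)// -/(F _) !FV//.
  by rewrite invgM (Hcls_gactM Jg')//; [exact: dcosetV|exact: SV].
move=> /(_ H) e; apply: (mulIf (n0 g^-1%g)).
rewrite -[LHS]mulrA [X in _ * X = _]mulr_natr e -[X in _ * X = _]mulr_natr.
rewrite [RHS]mulrAC divfK//.
by ring.
Qed.

Lemma hecke_adjoint S g :
  is_adjoint (@Lip _ _ _ _ U q) (hecke_op g)
    (fun x => ((ncosets (dcoset S g) S)%:R / (ncosets (dcoset S g^-1%g) S)%:R)
      *: hecke_op g^-1%g x).
Proof.
move=> x y; have [S' [v [w [vS wS -> ->]]]] := Lq_rep2 x y.
rewrite hecke_adjoint_ncong// ipZr; last exact: Lip_inner_product.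
rewrite rmorphM fmorphV !rmorph_nat; congr (_ * _).
(* The ratio is taken at [S] while the vectors live at [S']; both ratios equal the one at the
   intersection. *)
pose J := ncongI S S'.
rewrite (modular_ratio_sub hecke _ _ (ncong_congruence S) (ncongP J)); last first.
  exact: subIsetl.
apply: (modular_ratio_sub hecke _ _ (ncong_congruence S') (ncongP J)).
exact: subIsetr.
Qed.

Lemma hecke_op_bound g :
  op_bound (@Lip _ _ _ _ U q) (hecke_op g) (ncosets (dcoset Gam g) Gam)%:R.
Proof.
split=> // x; have [S [v [vS ->]]] := Lq_rep x.
pose J := ncong_hker S g; have Jg : J `<=` hker Gam S g by [].
have cS := ncong_congruence S; have sS := ncong_subgroup S.
have sG := subgroupP Gam; have fin := congruence_finite_dcoset hecke g cS.
have finS := congruence_finite_index hecke cS.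
set n := ncosets _ _; set m := ncosets Gam S.
have m0 : m%:R != 0 :> R[i].
  by rewrite pnatr_eq0 -lt0n; case: sG => G1 _ _; exact: ncosets_gt0 finS G1.
set a := uhm_ip U (Hcls q S v) (Hcls q S v).
have cnt : #|` fset_set (lcosets (dcoset Gam g) S)| = (n * m)%N.
  have := @coset_sum_refine G nat (fun=> 1%N) (dcoset Gam g) Gam S sG sS
    (@ncong_sub _ _ S) (rinv_dcoset (g:=g) sG (@subset_refl _ Gam)) (hecke g) fin finS
    (fun _ _ _ _ => erefl).
  by rewrite !fsum_const// -/(ncosets _ _) -mulrnA -!/(_%:R) !natn.
(* The sum has [n m] terms of square norm [a], hence square norm at most [(n m)^2 a]; the squared
   factor [m^-1] leaves [n^2 a]. *)
have le : Lip U (hecke_op g (Lin (Hcls q S v))) (hecke_op g (Lin (Hcls q S v)))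
    <= n%:R ^+ 2 * a.
  rewrite (hecke_op_cls hecke Jg)// LipE// /hecke_avg fsbig_finite//.
  rewrite ipZl; last exact: ipP.
  rewrite ipZr; last exact: ipP.
  rewrite fmorphV rmorph_nat mulrA -/m.
  have := ip_sum_le (ipP J) (fset_set (lcosets (dcoset Gam g) S))
    (fun c => Hcls q J (gact (xget 1%g c) v)).
  rewrite [X in _ <= _ * X -> _](_ : _ = (n * m)%:R * a); last first.
    rewrite -cnt mulr_natl -[RHS]fsum_const// fsbig_finite//.
    apply: eq_big_seq => c; rewrite in_fset_set// inE => hc.
    rewrite (@uhm_ip_gact S J)//; apply: hker_conj; first exact: ncongP.
    exact: (coset_rep_in sS (@ncong_rinv _ _ S _) hc).
  rewrite -[size _]/(#|` _|) cnt => /(ler_wpM2l (x := m%:R^-1 * m%:R^-1)).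
  rewrite mulr_ge0 ?invr_ge0// => /(_ isT)/le_trans; apply.
  by rewrite natrM le_eqVlt; apply/orP; left; apply/eqP; field.
rewrite /ipnorm (LipE U q_gt0).
rewrite -[n%:R]ger0_norm// -sqrtr_sqr -sqrtrM ?sqr_ge0//.
apply: ler_wsqrtr.
have : complex.Re (Lip U (hecke_op g (Lin (Hcls q S v)))
    (hecke_op g (Lin (Hcls q S v)))) <= complex.Re (n%:R ^+ 2 * a).
  by move: le; rewrite lecE => /andP[].
suff -> : complex.Re (n%:R ^+ 2 * a) = n%:R ^+ 2 * complex.Re a by [].
rewrite -natrX -[_%:R in LHS](rmorph_nat (real_complex R)) -natrX.
by case: a {le} => ? ? /=; rewrite mul0r subr0.
Qed.

Lemma hecke_op_opnorm g : bounded_operator (@Lip _ _ _ _ U q) (hecke_op g) /\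
  opnorm (@Lip _ _ _ _ U q) (hecke_op g) <= (ncosets (dcoset Gam g) Gam)%:R.
Proof.
split.
  by split; [exact: hecke_op_linear|eexists; exact: hecke_op_bound].
by apply: ge_inf; [exists 0 => c []|exact: hecke_op_bound].
Qed.

End UnitaryHecke.

(** * Compactness and topological groups *)

Lemma compact_finite_cover (X : topologicalType) (K : set X) (I : eqType)
    (O : I -> set X) : compact K ->
  (forall x, K x -> exists i, nbhs x (O i)) ->
  exists s : seq I, forall x, K x -> exists2 i, i \in s & O i x.
Proof.
move=> /compact_near_coveringP cK hO.
(* Finite lists ordered by inclusion give a filter; near-covering compactness along it yields one
   list that serves all points of [K]. *)
pose F : set_system (seq I) :=
  [set A : set (seq I) | exists s0 : seq I,
     forall s : seq I, {subset s0 <= s} -> A s].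
have FF : Filter F.
  split; first by exists [::].
  - move=> A B [s hA] [t hB]; exists (s ++ t) => u hu; split.
      by apply: hA => i si; apply: hu; rewrite mem_cat si.
    by apply: hB => i ti; apply: hu; rewrite mem_cat ti orbT.
  - by move=> A B AB [s hA]; exists s => u /hA /AB.
have [|s hs] := cK _ F (fun s x => exists2 i, i \in s & O i x) FF; last first.
  by exists s; exact: hs.
move=> x Kx; have [i hi] := hO x Kx.
exists (O i, [set s : seq I | i \in s]).
  by split=> //; exists [:: i] => s; apply; rewrite mem_head.
by case=> y s [/= Oy si]; exists i.
Qed.

Section TopologicalGroups.
Variable T : topologicalGroupType.
Implicit Types (A B K N W : set T) (g h x y : T).

Definition lmul x A : set T := [set (x * a)%g | a in A].
Definition rmul A g : set T := [set (a * g)%g | a in A].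

Lemma lmulP x A y : lmul x A y <-> A (x^-1 * y)%g.
Proof.
split=> [[a Aa <-]|Ay]; first by rewrite mulKg.
by exists (x^-1 * y)%g => //; rewrite mulVKg.
Qed.

Lemma rmulP A g y : rmul A g y <-> A (y * g^-1)%g.
Proof.
split=> [[a Aa <-]|Ay]; first by rewrite mulgK.
by exists (y * g^-1)%g => //; rewrite mulgVK.
Qed.

Lemma rmulM A g h : rmul (rmul A g) h = rmul A (g * h)%g.
Proof. by apply/seteqP; split=> x; rewrite !rmulP invgM mulgA. Qed.

Lemma rmul1 A : rmul A 1%g = A.
Proof. by apply/seteqP; split=> x; rewrite !rmulP invg1 mulg1. Qed.

Lemma lmul_rmul x A g : lmul x (rmul A g) = rmul (lmul x A) g.
Proof. by apply/seteqP; split=> y; rewrite !(lmulP, rmulP) mulgA. Qed.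

Lemma rmulS A B g : A `<=` B -> rmul A g `<=` rmul B g.
Proof. by move=> AB _ [a /AB Ba <-]; exists a. Qed.

Lemma mulgl_continuous x : continuous (fun y : T => x * y)%g.
Proof.
move=> y; have c : (x, z) @[z --> y] --> (x, y).
  by apply: (@cvg_pair _ _ _ _ (nbhs x) (nbhs y)); [exact: cvg_cst|exact: cvg_id].
exact: (cvg_comp _ _ c (@mulg_continuous T (x, y))).
Qed.

Lemma mulgr_continuous x : continuous (fun y : T => y * x)%g.
Proof.
move=> y; have c : (z, x) @[z --> y] --> (y, x).
  by apply: (@cvg_pair _ _ _ _ (nbhs y) (nbhs x)); [exact: cvg_id|exact: cvg_cst].
exact: (cvg_comp _ _ c (@mulg_continuous T (y, x))).
Qed.

Lemma open_lmul x A : open A -> open (lmul x A).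
Proof.
move=> oA; have -> : lmul x A = (fun y => x^-1 * y)%g @^-1` A.
  by apply/seteqP; split=> y; rewrite lmulP.
by apply: open_comp => // y _; exact: mulgl_continuous.
Qed.

Lemma open_rmul A g : open A -> open (rmul A g).
Proof.
move=> oA; have -> : rmul A g = (fun y => y * g^-1)%g @^-1` A.
  by apply/seteqP; split=> y; rewrite rmulP.
by apply: open_comp => // y _; exact: mulgr_continuous.
Qed.

Lemma open_invg A : open A -> open [set x | A x^-1%g].
Proof. by move=> oA; apply: open_comp => // y _; exact: invg_continuous. Qed.

Lemma nbhs1_lmul A x : nbhs x A -> nbhs 1%g [set w | A (x * w)%g].
Proof. by move=> nA; apply: (mulgl_continuous (x := x)); rewrite mulg1. Qed.

Lemma nbhs1_conj N g : nbhs 1%g N -> nbhs 1%g [set w | N (g^-1 * w * g)%g].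
Proof.
move=> nN; have nN' : nbhs (g^-1 * 1)%g [set w | N (w * g)%g].
  by apply: (mulgr_continuous (x := g)); rewrite mulg1 mulVg.
exact: (mulgl_continuous (x := g^-1%g)) nN'.
Qed.

Lemma nbhs1_sqr N : nbhs 1%g N -> exists W, [/\ open W, W 1%g,
  (forall a, W a -> W a^-1%g) & forall a b, W a -> W b -> N (a * b)%g].
Proof.
move=> nN.
have : nbhs ((1, 1) : T * T)%g [set xy : T * T | N (xy.1 * xy.2)%g].
  by apply: mulg_continuous => /=; rewrite mulg1.
move=> [[P Q] [/= nP nQ] PQ].
have : nbhs (1%g : T) (P `&` Q) by exact: filterI.
rewrite nbhsE => -[W0 [oW0 W01] W0PQ].
exists (W0 `&` [set x | W0 x^-1%g]); split.
- by apply: openI => //; exact: open_invg.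
- by split=> //=; rewrite invg1.
- by move=> a [? ?]; split=> //=; rewrite invgK.
- by move=> a b [/W0PQ[Pa _] _] [/W0PQ[_ Qb] _]; exact: (PQ (a, b)).
Qed.

Definition precpt A := exists2 K, compact K & A `<=` K.

Lemma precpt_sub A B : A `<=` B -> precpt B -> precpt A.
Proof. by move=> AB [K cK BK]; exists K => //; exact: subset_trans BK. Qed.

Lemma precpt_rmul A g : precpt A -> precpt (rmul A g).
Proof.
move=> [K cK AK]; exists (rmul K g); last exact: rmulS.
apply: continuous_compact => //; apply: continuous_subspaceT.
exact: mulgr_continuous.
Qed.

Lemma precpt_lmul x A : precpt A -> precpt (lmul x A).
Proof.
move=> [K cK AK]; exists (lmul x K); last by move=> _ [a /AK Ka <-]; exists a.
apply: continuous_compact => //; apply: continuous_subspaceT.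
exact: mulgl_continuous.
Qed.

Lemma precpt_cover A W : precpt A -> open W -> W 1%g ->
  exists s : seq T, forall x, A x -> exists2 i, i \in s & lmul i W x.
Proof.
move=> [K cK AK] oW W1.
have [|s hs] := @compact_finite_cover _ K T (lmul^~ W) cK.
  move=> x _; exists x; apply: open_nbhs_nbhs; split; first exact: open_lmul.
  by apply/lmulP; rewrite mulVg.
by exists s => x /AK; exact: hs.
Qed.

(** A margin on both sides, [W P W] inside [Q]: in [rmul_compare] one use of [translate_average]
    spends it on the left and the other, after an inversion, on the right. *)
Definition well_inside (P Q : set T) := exists2 W, nbhs 1%g W &
  forall a p b, W a -> P p -> W b -> Q (a * p * b)%g.

Lemma well_inside_sub P Q : well_inside P Q -> P `<=` Q.
Proof.
move=> [W /nbhs_singleton W1 h] p Pp.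
by have := h 1%g p 1%g W1 Pp W1; rewrite mul1g mulg1.
Qed.

Lemma well_inside_interp P Q : open P -> well_inside P Q ->
  exists P', [/\ open P', well_inside P P' & well_inside P' Q].
Proof.
move=> oP [W nW h]; have [W1 [oW1 W11 W1V W1M]] := nbhs1_sqr nW.
have n1 : nbhs 1%g W1 by exact: open_nbhs_nbhs.
(* The witness is [W1 P W1]; since [W1 W1] lies in [W], a margin [W1] is left on either side of
   it. *)
exists (\bigcup_(a in W1) \bigcup_(b in W1) lmul a (rmul P b)); split.
- apply: bigcup_open => a _; apply: bigcup_open => b _.
  exact/open_lmul/open_rmul.
- exists W1 => // a p b Wa Pp Wb; exists a => //; exists b => //.
  by apply/lmulP/rmulP; rewrite -!mulgA mulKg mulgV mulg1.
- exists W1 => // a _ b Wa [a' Wa' [b' Wb' [_ [p Pp <-] <-]]] Wb.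
  have -> : (a * (a' * (p * b')) * b = (a * a') * p * (b' * b))%g by rewrite !mulgA.
  by apply: h => //; exact: W1M.
Qed.

Lemma well_inside_exists N : nbhs 1%g N -> exists P, [/\ open P, P 1%g & well_inside P N].
Proof.
move=> nN; have [W [oW W1 WV WM]] := nbhs1_sqr nN.
have [P [oP P1 PV PM]] := nbhs1_sqr (open_nbhs_nbhs (conj oW W1)).
exists P; split=> //; exists P; first exact: open_nbhs_nbhs.
move=> a p b Pa Pp Pb; apply: WM; first exact: PM.
by rewrite -[b]mulg1; exact: PM.
Qed.

End TopologicalGroups.

(** * The coset space of a lattice *)

Section LatticeMeasure.
Variables (R : realType) (T : topologicalGroupType) (L : set T).
Hypotheses (hausT : hausdorff_space T) (lcT : locally_compact [set: T]).
Hypotheses (sL : is_subgroup L) (dL : isolated L = L).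
Variable mu : {finite_measure set (borel_coset_space L) -> \bar R}.
Hypotheses (rad : radon mu) (mu_gt0 : (0 < mu setT)%E).
Hypothesis mu_inv : forall g (A : set (borel_coset_space L)), measurable A ->
  mu (coset_translate g @` A) = mu A.
Local Notation X := (coset_space L).
Local Notation XB := (borel_coset_space L).
Implicit Types (A B K N U V W : set T) (g h x y : T).

Definition cpi : T -> X := lquot_pi L.

Lemma cpiP x y : cpi x = cpi y <-> L (y^-1 * x)%g.
Proof.
split=> [e|/lcoset_eqP-/(_ sL) e].
  by apply/lcoset_eqP => //; exact: (congr1 (@proj1_sig _ _) e).
by have : lquot_pi L x = lquot_pi L y by apply: val_inj => /=; exact: e.
Qed.

Lemma cpi_surj (c : X) : exists x, c = cpi x.
Proof. by exists (lquot_repr c); rewrite /cpi lquot_reprK. Qed.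

Lemma cpi_mulr x l : L l -> cpi (x * l)%g = cpi x.
Proof. by move=> Ll; apply/cpiP; rewrite mulKg. Qed.

Lemma coset_translate_cpi g x : coset_translate g (cpi x) = cpi (g * x)%g.
Proof.
rewrite /coset_translate -/cpi; apply/cpiP.
rewrite invgM -mulgA mulKg; apply/cpiP; exact: lquot_reprK.
Qed.

Lemma open_cosetE (O : set X) : open O = open (cpi @^-1` O).
Proof.
rewrite -[open O]/(@quotient_open _ (lquot L) O) /quotient_open.
by rewrite unlock.
Qed.

(** The saturation of [A] is the union of its right translates by [L]. *)
Lemma open_cpi A : open A -> open (cpi @` A).
Proof.
move=> oA; rewrite open_cosetE.
have -> : cpi @^-1` (cpi @` A) = \bigcup_(l in L) rmul A l.
  apply/seteqP; split=> [x [a Aa /cpiP xa]|_ [l Ll [a Aa <-]]].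
    have [_ _ LV] := sL; exists (x^-1 * a)^-1%g; first exact: LV.
    by exists a => //; rewrite invgM invgK mulVKg.
  by exists a => //; rewrite cpi_mulr.
by apply: bigcup_open => l _; exact: open_rmul.
Qed.

Lemma discrete_nbhs1 : exists2 N, nbhs 1%g N & forall l, N l -> L l -> l = 1%g.
Proof.
have [L1 _ _] := sL; have : isolated L 1%g by rewrite dL.
case=> _ [N nN e]; exists N => // l Nl Ll.
by have : (N `&` L) l by []; rewrite e.
Qed.

(** Two elements of [L] close to a point [z] of the closure have quotient in [N], hence coincide. So
    a single [l] of [L] lies near [z]; were it not [z], a neighbourhood of [z] would miss it. *)
Lemma discrete_closed : closed L.
Proof.
move=> z clz; have [_ LM LV] := sL; have [N nN Nl] := discrete_nbhs1.
have [W [oW W1 WV WM]] := nbhs1_sqr nN.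
have nz : nbhs z (lmul z W).
  apply: open_nbhs_nbhs; split; first exact: open_lmul.
  by apply/lmulP; rewrite mulVg.
have [l [Ll zl]] := clz _ nz.
have [->//|lz] := eqVneq z l.
have := hausT; rewrite open_hausdorff => /(_ _ _ lz)[[P Q] /= [zP lQ] [oP oQ /eqP PQ]].
have nP : nbhs z P by apply: open_nbhs_nbhs; split=> //; move: zP; rewrite inE.
have [l' [Ll' [zl' Pl']]] := clz _ (filterI nz nP).
have : (l^-1 * l')%g = 1%g.
  apply: Nl; last by apply: LM => //; exact: LV.
  have -> : (l^-1 * l' = (z^-1 * l)^-1 * (z^-1 * l'))%g.
    by rewrite invgM invgK -mulgA mulVKg.
  by apply: WM; [apply: WV|]; exact/lmulP.
move=> /(congr1 (fun x => l * x)%g); rewrite mulVKg mulg1 => ll'.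
have : (P `&` Q) l by split; [rewrite -ll'|move: lQ; rewrite inE].
by rewrite PQ.
Qed.

(** For distinct cosets of [x] and [y], the set [x^-1 W W y] misses the closed set [L] when [W] is
    small and symmetric, so [W x] and [W y] have disjoint images. This makes compact subsets of the
    coset space closed, hence Borel. *)
Lemma hausdorff_coset_space : hausdorff_space X.
Proof.
have [L1 LM LV] := sL; rewrite open_hausdorff => c d.
have [x ->] := cpi_surj c; have [y ->] := cpi_surj d => xy.
have nL : ~ L (x^-1 * y)%g.
  by move=> h; move: xy => /eqP; apply; apply/esym/cpiP.
have oL : open (~` L) by apply: closed_openC; exact: discrete_closed.
have : nbhs 1%g [set w | (~` L) (x^-1 * w * y)%g].
  apply: (@nbhs1_lmul _ [set w | (~` L) (w * y)%g] x^-1%g).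
  have : nbhs (x^-1 * y)%g (~` L) by exact: open_nbhs_nbhs.
  exact: mulgr_continuous.
move=> /nbhs1_sqr[W [oW W1 WV WM]].
exists (cpi @` (rmul W x), cpi @` (rmul W y)) => /=.
  split; rewrite inE /=.
    by exists x => //; apply/rmulP; rewrite mulgV.
  by exists y => //; apply/rmulP; rewrite mulgV.
split; [exact/open_cpi/open_rmul|exact/open_cpi/open_rmul|apply/eqP].
rewrite -subset0 => _ [[_ [a Wa <-] <-] [_ [b Wb <-] /cpiP ab]].
apply: (WM a^-1%g b (WV _ Wa) Wb).
by rewrite invgM -!mulgA !mulgA in ab *.
Qed.

Lemma measurable_open (O : set X) : open O -> measurable (O : set XB).
Proof. by move=> oO; exact: sub_sigma_algebra. Qed.

Lemma measurable_compact (C : set X) : compact C -> measurable (C : set XB).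
Proof.
move=> cC; rewrite -[C]setCK; apply: measurableC; apply: measurable_open.
by apply: closed_openC; exact: compact_closed hausdorff_coset_space cC.
Qed.

Lemma measurable_cpi A : open A -> measurable (cpi @` A : set XB).
Proof. by move=> oA; exact: (measurable_open (open_cpi oA)). Qed.

(** * Measures of images in the coset space *)

Definition mf (E : set XB) : R := fine (mu E).

Lemma mfK (E : set XB) : measurable E -> (mf E)%:E = mu E.
Proof. by move=> mE; rewrite fineK// fin_num_measure. Qed.

Lemma mf_ge0 (E : set XB) : 0 <= mf E.
Proof. by rewrite fine_ge0. Qed.

Lemma mf_le (E F : set XB) : measurable E -> measurable F -> E `<=` F -> mf E <= mf F.
Proof.
by move=> mE mF EF; rewrite -lee_fin !mfK// le_measure// inE.
Qed.

Lemma mfT_gt0 : 0 < mf setT.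
Proof. by rewrite -lte_fin mfK. Qed.

Lemma mf_bigsetU (E : nat -> set XB) n : (forall i, measurable (E i)) ->
  trivIset setT E -> mf (\big[setU/set0]_(i < n) E i) = \sum_(i < n) mf (E i).
Proof.
move=> mE tE; apply: EFin_inj; rewrite mfK; last exact: bigsetU_measurable.
by rewrite measure_bigsetU// -sumEFin; apply: eq_bigr => i _; rewrite mfK.
Qed.

(** Monotonicity of the integral for nonnegative step functions. The sets in a list may overlap, so
    a pointwise count of multiplicities becomes an inequality of measures. *)
Lemma mf_step_le (s t : seq (R * set XB)) :
  (forall p, p \in s -> 0 <= p.1 /\ measurable p.2) ->
  (forall p, p \in t -> 0 <= p.1 /\ measurable p.2) ->
  (forall c, \sum_(p <- s) p.1 * \1_(p.2) c <= \sum_(p <- t) p.1 * \1_(p.2) c) ->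
  \sum_(p <- s) p.1 * mf p.2 <= \sum_(p <- t) p.1 * mf p.2.
Proof.
have intE (r : seq (R * set XB)) :
    (forall p, p \in r -> 0 <= p.1 /\ measurable p.2) ->
    measurable_fun setT (fun c : XB => (\sum_(p <- r) p.1 * \1_(p.2) c : R)%:E) /\
    (\int[mu]_c (\sum_(p <- r) p.1 * \1_(p.2) c : R)%:E = (\sum_(p <- r) p.1 * mf p.2)%:E)%E.
  elim: r => [|p r IH] hr.
    split; first by under eq_fun do rewrite big_nil; exact: measurable_cst.
    by under eq_integral do rewrite big_nil; rewrite big_nil integral0.
  have [p0 mp] := hr p (mem_head _ _).
  have {}hr p' : p' \in r -> 0 <= p'.1 /\ measurable p'.2.
    by move=> h; apply: hr; rewrite in_cons h orbT.
  have [mIH eIH] := IH hr.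
  have mfp : measurable_fun setT (fun c : XB => (p.1 * \1_(p.2) c : R)%:E).
    apply/measurable_EFinP; apply: measurable_funM; first exact: measurable_cst.
    exact: measurable_indic.
  split.
    under eq_fun do rewrite big_cons EFinD.
    exact: emeasurable_funD.
  under eq_integral do rewrite big_cons EFinD.
  rewrite ge0_integralD//; last 2 first.
  - by move=> c _; rewrite lee_fin mulr_ge0.
  - move=> c _; rewrite lee_fin big_seq sumr_ge0// => p' /hr[? _].
    by rewrite mulr_ge0.
  rewrite eIH big_cons EFinD; congr (_ + _)%E.
  under eq_integral do rewrite EFinM.
  rewrite ge0_integralZl_EFin//; last first.
    by apply/measurable_EFinP; exact: measurable_indic.
  by rewrite integral_indic// setIT EFinM mfK.
move=> hs ht st; have [ms es] := intE _ hs; have [mt et] := intE _ ht.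
rewrite -lee_fin -es -et; apply: ge0_le_integral => //.
- move=> c _; rewrite lee_fin big_seq sumr_ge0// => p /hs[? _].
  by rewrite mulr_ge0.
- by move=> c _; rewrite lee_fin.
Qed.

(** Points equal modulo [L] are counted once, so [lam] is additive on disjoint pieces of a set on
    which [cpi] is injective ([cinj]). *)
Definition lam A : R := mf (cpi @` A).

Lemma lam_ge0 A : 0 <= lam A. Proof. exact: mf_ge0. Qed.

Lemma lam_le A B : open A -> open B -> A `<=` B -> lam A <= lam B.
Proof.
move=> oA oB AB; apply: mf_le; [exact: measurable_cpi..|exact: image_subset].
Qed.

Lemma lam_leT A : open A -> lam A <= mf setT.
Proof. by move=> oA; apply: mf_le => //; exact: measurable_cpi. Qed.

Lemma lam_lmul x A : open A -> lam (lmul x A) = lam A.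
Proof.
move=> oA; congr fine; rewrite -(mu_inv x (measurable_cpi oA)).
congr (mu _); apply/seteqP; split=> [_ [_ [a Aa <-] <-]|_ [_ [a Aa <-] <-]].
  by exists (cpi a); [exists a|rewrite coset_translate_cpi].
by exists (x * a)%g; [exists a|rewrite coset_translate_cpi].
Qed.

Lemma lam_rmulL A l : L l -> lam (rmul A l) = lam A.
Proof.
move=> Ll; congr mf; apply/seteqP; split=> [_ [_ [a Aa <-] <-]|_ [a Aa <-]].
  by exists a => //; rewrite cpi_mulr.
by exists (a * l)%g; [exists a|rewrite cpi_mulr].
Qed.

Lemma inner_compact (O : set X) (e : R) : open O -> 0 < e ->
  exists C : set X, [/\ compact C, C `<=` O & mf O < mf C + e].
Proof.
move=> oO e0; have [_ inn] := rad.
have finO : mu O \is a fin_num by rewrite fin_num_measure//; exact: measurable_open.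
have := inn _ oO; set S := [set mu C | C in _] => eS.
have fS : ereal_sup S \is a fin_num by rewrite -eS.
have [_ [C [cC CO] <-]] := ub_ereal_sup_adherent e0 fS.
rewrite -eS => h; exists C; split=> //.
rewrite -ltrBlDr -lte_fin EFinB !mfK//; [exact: measurable_compact|].
exact: measurable_open.
Qed.

(** Finitely many translates of the image of [A], each of measure [lam A], cover a compact set of
    positive measure. *)
Lemma lam_gt0 A x : open A -> A x -> 0 < lam A.
Proof.
move=> oA Ax; rewrite lt_neqAle lam_ge0 andbT; apply/eqP => l0.
(* With the tolerance [mf setT], the inequality [hC] says exactly that [C] has positive measure. *)
have [C [cC _ hC]] := inner_compact (@openT X) mfT_gt0.
have C0 : 0 < mf C.
  by rewrite -(ltrD2r (mf setT)) add0r.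
have [|s hs] := @compact_finite_cover _ C T (fun g => cpi @` (lmul g A)) cC.
  move=> c _; have [y ->] := cpi_surj c; exists (y * x^-1)%g.
  apply: open_nbhs_nbhs; split; first exact/open_cpi/open_lmul.
  by exists y => //; exists x => //; rewrite mulgVK.
have := @mf_step_le [:: (1, C)] [seq (1, cpi @` (lmul g A)) | g <- s].
rewrite big_seq1 big_map /= mul1r.
rewrite [X in mf C <= X]big1; last first.
  by move=> g _; rewrite -/(lam _) lam_lmul// -l0 mulr0.
move=> H; suff : mf C <= 0 by rewrite leNgt C0.
apply: H.
- by move=> p; rewrite inE => /eqP->/=; split=> //; exact: measurable_compact.
- move=> p /mapP[g _ ->] /=; split=> //; exact: (measurable_cpi (open_lmul g oA)).
- move=> c; rewrite big_seq1 big_map /= mul1r indicE.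
  have [Cc|_] := boolP (c \in C); last first.
    by rewrite sumr_ge0// => g _; rewrite mul1r indicE.
  have [g gs gc] := hs c (set_mem Cc).
  rewrite (big_rem g)//= mul1r indicE mem_set// lerDl.
  by rewrite sumr_ge0// => g' _; rewrite mul1r indicE.
Qed.

(** * Comparison of right translates *)

Definition cinj A := forall a b, A a -> A b -> cpi a = cpi b -> a = b.

Lemma cinj_sub A B : A `<=` B -> cinj B -> cinj A.
Proof. by move=> AB iB a b /AB Ba /AB Bb; exact: iB. Qed.

Lemma cinj_lmul x A : cinj A -> cinj (lmul x A).
Proof.
move=> iA _ _ [a Aa <-] [b Ab <-] /cpiP; rewrite invgM -mulgA mulKg => /cpiP.
by move=> /(iA _ _ Aa Ab)->.
Qed.

Lemma tile_cover (O : nat -> set XB) n (c : XB) :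
  (exists2 i, (i < n)%N & O i c) -> exists2 i, (i < n)%N & seqDU O i c.
Proof.
move=> [i ltin Oi]; have : (\big[setU/set0]_(k < n) O k) c.
  by rewrite -bigcup_mkord; exists i.
by rewrite bigsetU_seqDU -bigcup_mkord => -[j ltj Ej]; exists j.
Qed.

(* A finite form of Fubini for the average of the translates x V over x in A:
   A is tiled by pieces of measure mf (E i) lying in translates x_i W. *)
Lemma translate_average A Am Vm V W g :
  open A -> cinj A -> precpt A -> open Am -> open Vm -> open V ->
  nbhs 1%g W -> (forall w v, W w -> Vm v -> V (w * v)%g) ->
  (forall y v, Am y -> Vm v -> A (y * v^-1)%g) ->
  lam [set v | Vm v^-1%g] * lam (rmul Am g) <= lam A * lam (rmul V g).
Proof.
move=> oA iA pA oAm oVm oV; rewrite nbhsE => -[W' [oW' W'1] W'W] WV AmA.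
have [s hs] := precpt_cover pA oW' W'1.
pose xi i := nth 1%g s i; set n := size s in hs.
pose O i : set XB := cpi @` (A `&` lmul (xi i) W').
have mO i : measurable (O i).
  by apply: measurable_cpi; apply: openI => //; exact: open_lmul.
pose E := seqDU O; have mE i : measurable (E i) by exact: seqDU_measurable.
have sumE : \sum_(i < n) mf (E i) <= lam A.
  rewrite -mf_bigsetU//; last exact: trivIset_seqDU.
  apply: mf_le; [exact: bigsetU_measurable|exact: measurable_cpi|].
  rewrite -bigsetU_seqDU -bigcup_mkord => c [i _ [a [Aa _] <-]].
  by exists a.
have covE a : A a -> exists2 i, (i < n)%N & E i (cpi a).
  move=> Aa; apply: tile_cover; have [x xs xa] := hs a Aa.
  exists (index x s); first by rewrite index_mem.
  by exists a => //; split=> //; rewrite /xi nth_index.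
have oVi : open [set v | Vm v^-1%g] by exact: open_invg.
have oVg i : open (lmul (xi i) (rmul V g)) by exact/open_lmul/open_rmul.
(* Outer inequality: for each [y] in [Am], the tiles [i] with [y] in [x_i V] have total measure at
   least [lam [set v | Vm v^-1%g]]. *)
pose t := [seq (mf (E i), cpi @` (lmul (xi i) (rmul V g))) | i <- index_iota 0 n].
have := @mf_step_le [:: (lam [set v | Vm v^-1%g], cpi @` (rmul Am g))] t.
rewrite big_seq1 /t big_map /= -/(lam _) => H.
apply: (@le_trans _ _ (\sum_(0 <= i < n) mf (E i) * lam (rmul V g))); last first.
  by rewrite -mulr_suml ler_wpM2r ?lam_ge0// big_mkord.
have -> : \sum_(0 <= i < n) mf (E i) * lam (rmul V g) =
    \sum_(0 <= i < n) mf (E i) * mf (cpi @` (lmul (xi i) (rmul V g))).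
  by apply: eq_bigr => i _; rewrite -/(lam _) lam_lmul//; exact: open_rmul.
apply: H.
- move=> p; rewrite inE => /eqP-> /=; split; first exact: lam_ge0.
  by apply: measurable_cpi; exact: open_rmul.
- move=> p /mapP[i _ ->] /=; split; first exact: mf_ge0.
  exact: (measurable_cpi (oVg i)).
move=> c; rewrite big_seq1 big_map /= indicE.
have [/set_mem|_] := boolP (c \in _); last first.
  by rewrite mulr0 sumr_ge0// => i _; rewrite mulr_ge0 ?mf_ge0 ?indicE.
move=> [_ [y Amy <-] <-]; rewrite mulr1.
rewrite -(lam_lmul y oVi) big_mkord.
(* Inner inequality, for fixed [y]: [y Vm^-1] lies in [A], so tiles cover its image. As [cpi] is
   injective on [A], a tile met by it has [y] in [x_i W Vm], hence in [x_i V]. *)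
pose u := [seq ((`[< lmul (xi i) V y >])%:R : R, E i) | i <- index_iota 0 n].
have := @mf_step_le [:: (1, cpi @` (lmul y [set v | Vm v^-1%g]))] u.
rewrite big_seq1 /u big_map /= mul1r -/(lam _) => H'.
apply: (@le_trans _ _ (\sum_(0 <= i < n) (`[< lmul (xi i) V y >])%:R * mf (E i))).
  apply: H'.
  - move=> p; rewrite inE => /eqP-> /=; split=> //.
    exact: (measurable_cpi (open_lmul y oVi)).
  - by move=> p /mapP[i _ ->] /=; split; [exact: ler0n|exact: mE].
  move=> d; rewrite big_seq1 big_map /= mul1r indicE.
  have [/set_mem|_] := boolP (d \in _); last first.
    by rewrite sumr_ge0// => i _; rewrite mulr_ge0 ?indicE.
  move=> [_ [v Vv <-] <-].
  have Ayv : A (y * v)%g by rewrite -[v]invgK; exact: AmA.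
  have [i ltin Ei] := covE _ Ayv.
  have [a [Aa xa] /(iA _ _ Aa Ayv) ea] := subset_seqDU Ei.
  have Vy : lmul (xi i) V y.
    apply/lmulP; have -> : ((xi i)^-1 * y = ((xi i)^-1 * a) * v^-1)%g.
      by rewrite ea -!mulgA mulgV mulg1.
    by apply: WV => //; apply: W'W; exact/lmulP.
  rewrite big_mkord (bigD1 (Ordinal ltin))//= asboolT// mul1r indicE mem_set//.
  by rewrite lerDl sumr_ge0// => j _; rewrite mulr_ge0 ?indicE.
rewrite big_mkord; apply: ler_sum => i _; rewrite mulrC ler_wpM2l ?mf_ge0//.
case: asboolP => // Vy; rewrite indicE mem_set//.
by exists (y * g)%g => //; rewrite lmul_rmul; exists y.
Qed.

(** Inner regularity lifted to [T]. A compact part of the image of [A g] is covered by finitely many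
    images of [a N_a g] with [a N_a N_a] inside [A]; the union of the [a N_a] is [Am], and the
    intersection of the [N_a] is the margin [N]. *)
Lemma inner_open A g (e : R) : open A -> 0 < e ->
  exists Am N, [/\ open Am, nbhs 1%g N, forall a n, Am a -> N n -> A (a * n)%g
    & lam (rmul A g) < lam (rmul Am g) + e].
Proof.
move=> oA e0; have oAg := open_cpi (open_rmul g oA).
have [C [cC CA hC]] := inner_compact oAg e0.
have /choice[N hN] (a : T) : exists N : set T, A a ->
    [/\ open N, N 1%g & forall n m, N n -> N m -> A (a * n * m)%g].
  have [Aa|] := pselect (A a); last by move=> nA; exists set0.
  have [N [oN N1 _ NM]] := nbhs1_sqr (nbhs1_lmul (open_nbhs_nbhs (conj oA Aa))).
  by exists N => _; split=> // n m Nn Nm; rewrite -mulgA; exact: NM.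
(* [N a] is arbitrary for [a] outside [A]; the guard makes [B a] empty there. *)
pose B a := [set x | A a /\ lmul a (N a) x].
have oB a : open (B a).
  have [Aa|nA] := pselect (A a); last first.
    by rewrite (_ : B a = set0); [exact: open0|apply/seteqP; split=> x []].
  rewrite (_ : B a = lmul a (N a)); last by apply/seteqP; split=> x => [[]|].
  by apply: open_lmul; case: (hN a Aa).
have [|s hs] := @compact_finite_cover _ C T (fun a => cpi @` (rmul (B a) g)) cC.
  move=> c /CA[_ [a Aa <-] <-]; exists a.
  apply: open_nbhs_nbhs; split; first exact/open_cpi/open_rmul.
  exists (a * g)%g => //; exists a => //; split=> //.
  by have [_ N1 _] := hN a Aa; exists 1%g => //; rewrite mulg1.
exists (\bigcup_(a in [set` s]) B a), [set n | forall a, a \in s -> A a -> N a n].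
have oU : open (\bigcup_(a in [set` s]) B a) by apply: bigcup_open => a _.
split=> //.
- elim: s {hs oU} => [|a s IH]; first by apply: filterS filterT => n _ a.
  have na : nbhs 1%g [set n | A a -> N a n].
    have [Aa|nA] := pselect (A a); last first.
      by apply: filterS filterT => n _ /nA.
    have [oN N1 _] := hN a Aa.
    by apply: filterS (open_nbhs_nbhs (conj oN N1)) => n Nn _.
  apply: filterS (filterI na IH) => n [h1 h2] b.
  by rewrite in_cons => /predU1P[->|]; [exact: h1|exact: h2].
- move=> x n [a /= sa [Aa /lmulP ax]] /(_ a sa Aa) Nn.
  have [_ _ NM] := hN a Aa.
  by have := NM _ _ ax Nn; rewrite mulVKg.
- apply: lt_le_trans hC _; rewrite lerD2r; apply: mf_le.
  + exact: measurable_compact.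
  + by apply: measurable_cpi; exact: open_rmul.
  + move=> c /hs[a sa [_ [x Bx <-] <-]].
    by exists (x * g)%g => //; exists x => //; exists a.
Qed.

(** If [p] grew by more than [d] at every interpolation between [P] and [Q], it would exceed its
    bound [M]. This yields nested sets with a margin and almost equal values, with no continuity of
    [p]. *)
Lemma well_inside_pigeonhole (p : set T -> R) (P Q : set T) (d M : R) :
  0 < d -> open P -> open Q -> 0 <= p P -> (forall S, open S -> p S <= M) ->
  well_inside P Q ->
  exists S S', [/\ open S, open S', P `<=` S, well_inside S S'
    & S' `<=` Q /\ p S' <= p S + d].
Proof.
move=> d0 oP oQ p0 pM wPQ; apply: contrapT => nex.
(* Above any [P'] still well inside [Q] there is room for [n] more growth steps; [n > M / d] is then
   absurd. *)
have step n : forall P', open P' -> P `<=` P' -> well_inside P' Q ->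
    p P' + n%:R * d <= M.
  elim: n => [|n IH] P' oP' PP' wP'; first by rewrite mul0r addr0 pM.
  have [P'' [oP'' w1 w2]] := well_inside_interp oP' wP'.
  have PP'' : P `<=` P'' by apply: subset_trans PP' _; exact: well_inside_sub.
  apply: le_trans (IH _ oP'' PP'' w2).
  have [le|/ltW lt] := leP (p P'') (p P' + d); last first.
    by move: lt; rewrite -natr1; lra.
  exfalso; apply: nex; exists P', P''; split=> //; split=> //.
  exact: well_inside_sub.
have := step (Num.truncn (M / d)).+1 P oP (@subset_refl _ _) wPQ.
have : M < (Num.truncn (M / d)).+1%:R * d by rewrite -ltr_pdivrMr// truncnS_gt.
by lra.
Qed.

(** Uniqueness of Haar measure by a test set [V] well inside [V']. Up to shrinking [A] and [B],
    [translate_average] gives [lam V^-1 * lam (A g) <= lam A * lam (V' g)] and [lam (V g) * lam B <=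
    lam (B g) * lam V'^-1]. Multiply, then divide by [p V = lam V^-1 * lam (V g)], which is almost
    [p V']. *)
Lemma rmul_compare A B g : open A -> open B -> cinj A -> cinj (rmul B g) ->
  precpt A -> precpt B -> lam (rmul A g) * lam B <= lam A * lam (rmul B g).
Proof.
move=> oA oB iA iBg pA pB.
set a := lam A; set a' := lam (rmul A g); set b := lam B; set b' := lam (rmul B g).
suff key (e : R) : 0 < e -> e <= 1 ->
    a' * b <= a * b' + e * (a' + b + a * b' + 1).
  have K0 : 0 < a' + b + a * b' + 1.
    have := lam_ge0 A; have := lam_ge0 B; have := lam_ge0 (rmul A g).
    by have := mulr_ge0 (lam_ge0 A) (lam_ge0 (rmul B g)); rewrite -/a -/b -/a' -/b'; lra.
  rewrite leNgt; apply/negP => lt.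
  set K := a' + b + a * b' + 1 in K0 key.
  (* This choice keeps the error below half of the supposed gap. *)
  pose e := Num.min 1 ((a' * b - a * b') / K / 2).
  have e0 : 0 < e by rewrite lt_min ltr01 !divr_gt0// subr_gt0.
  have e1 : e <= 1 by rewrite ge_min lexx.
  have := key e e0 e1.
  have : e * K <= (a' * b - a * b') / 2.
    rewrite -ler_pdivlMr// mulrAC ge_min.
    by rewrite [X in _ || X](_ : _ = true) ?orbT// mulrAC lexx.
  by lra.
move=> e0 e1.
have [Am [N1 [oAm nN1 AmA hA]]] := inner_open g oA e0.
have [Bm [N2 [oBm nN2 BmB]]] := inner_open 1%g oB e0.
rewrite !rmul1 => hB.
have nN : nbhs 1%g ([set n | N1 n^-1%g] `&` N2).
  apply: filterI => //; apply: (@invg_continuous T); by rewrite invg1.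
have [Q [oQ Q1 QN]] : exists Q, [/\ open Q, Q 1%g & Q `<=` [set n | N1 n^-1%g] `&` N2].
  by move: nN; rewrite nbhsE => -[Q [oQ Q1] QN]; exists Q.
have [P [oP P1 wPQ]] := well_inside_exists (open_nbhs_nbhs (conj oQ Q1)).
pose p V := lam [set v | V v^-1%g] * lam (rmul V g).
have oi V : open V -> open [set v | V v^-1%g] by exact: open_invg.
have p_ge0 V : 0 <= p V by rewrite mulr_ge0 ?lam_ge0.
have pP : 0 < p P.
  rewrite mulr_gt0//; first by apply: (@lam_gt0 _ 1%g); [exact: oi|rewrite /= invg1].
  by apply: (@lam_gt0 _ (1 * g)%g); [exact: open_rmul|exists 1%g].
have pM V : open V -> p V <= mf setT * mf setT.
  by move=> oV; apply: ler_pM; rewrite ?lam_ge0// lam_leT//;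
    [exact: oi|exact: open_rmul].
have [|V [V' [oV oV' PV [W nW wV] [V'Q pV]]]] :=
    @well_inside_pigeonhole p P Q (e * p P) _ _ oP oQ (p_ge0 P) pM wPQ.
  by rewrite mulr_gt0.
have VV' : V `<=` V' by apply: well_inside_sub; exists W.
have pPV : p P <= p V.
  apply: ler_pM; [exact: lam_ge0|exact: lam_ge0| |].
    by apply: lam_le; [exact: oi|exact: oi|move=> v; exact: PV].
  by apply: lam_le; [exact: open_rmul|exact: open_rmul|exact: rmulS].
have W1 : W 1%g by exact: nbhs_singleton.
have I : lam [set v | V v^-1%g] * lam (rmul Am g) <= a * lam (rmul V' g).
  apply: (@translate_average A Am V V' W g) => //.
    by move=> w v Ww Vv; rewrite -[(w * v)%g]mulg1; exact: wV.
  by move=> y v Amy /VV'/V'Q/QN[N1v _]; exact: AmA.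
(* Here the averaged set is [B g] and the test set is [g^-1 V^-1], whose inverse is [V g]; left
   invariance removes [g^-1] from the larger set [g^-1 V'^-1]. *)
have II : lam (rmul V g) * lam Bm <= b' * lam [set v | V' v^-1%g].
  have := @translate_average (rmul B g) Bm (lmul g^-1%g [set v | V v^-1%g])
    (lmul g^-1%g [set v | V' v^-1%g]) [set w | W (g * w^-1 * g^-1)%g] 1%g.
  rewrite !rmul1 (lam_lmul _ (oi _ oV')).
  rewrite (_ : [set v | lmul g^-1%g _ v^-1%g] = rmul V g); last first.
    apply/seteqP; split=> v /=; rewrite lmulP rmulP /= invgK !invgM invgK //.
  apply=> //.
  - exact: open_rmul.
  - exact: precpt_rmul.
  - exact/open_lmul/oi.
  - exact/open_lmul/oi.
  - have nWi : nbhs 1%g [set w | W w^-1%g].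
      by apply: (@invg_continuous T); rewrite invg1.
    apply: filterS (nbhs1_conj g^-1%g nWi) => w /=.
    by rewrite !invgM !invgK mulgA.
  - move=> w v /= Ww /lmulP; rewrite invgK /= => Vv; apply/lmulP; rewrite invgK /=.
    have -> : ((g * (w * v))^-1 = 1 * (g * v)^-1 * (g * w^-1 * g^-1))%g.
      by rewrite mul1g !invgM -!mulgA mulKg.
    exact: wV.
  - move=> y v Bmy /lmulP; rewrite invgK /= => Vv; apply/rmulP.
    have -> : (y * v^-1 * g^-1 = y * (g * v)^-1)%g by rewrite invgM mulgA.
    by apply: BmB => //; have /VV'/V'Q/QN[] := Vv.
have pV0 : 0 < p V by exact: lt_le_trans pPV.
have pV' : p V' <= (1 + e) * p V.
  apply: le_trans pV _; rewrite mulrDl mul1r lerD2l ler_wpM2l// ltW//.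
have prod : p V * (lam (rmul Am g) * lam Bm) <= a * b' * p V'.
  have := ler_pM _ _ I II.
  rewrite !mulr_ge0 ?lam_ge0// => /(_ isT isT); rewrite /p => h.
  have -> : lam [set v | V v^-1%g] * lam (rmul V g) * (lam (rmul Am g) * lam Bm) =
    lam [set v | V v^-1%g] * lam (rmul Am g) * (lam (rmul V g) * lam Bm) by ring.
  by apply: le_trans h _; rewrite le_eqVlt; apply/orP; left; apply/eqP; ring.
have ab0 : 0 <= a * b' by rewrite mulr_ge0 ?lam_ge0.
have : lam (rmul Am g) * lam Bm <= a * b' * (1 + e).
  rewrite -(ler_pM2l pV0); apply: le_trans prod _.
  rewrite [X in _ <= X](_ : _ = a * b' * ((1 + e) * p V)); last by ring.
  by rewrite ler_wpM2l.
have am0 := lam_ge0 (rmul Am g); have bm0 := lam_ge0 Bm.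
have a'0 := lam_ge0 (rmul A g); have b0 := lam_ge0 B.
rewrite -/a' -/b in hA hB a'0 b0 *.
move=> h.
have h2 : a' * b <= (lam (rmul Am g) + e) * (lam Bm + e).
  by apply: ler_pM => //; exact: ltW.
have bm_le : lam Bm <= b.
  apply: lam_le => // x Bx; rewrite -[x]mulg1; apply: BmB => //.
  exact: nbhs_singleton.
have am_le : lam (rmul Am g) <= a'.
  apply: lam_le; [exact: open_rmul..|apply: rmulS => x Ax].
  by rewrite -[x]mulg1; apply: AmA => //; exact: nbhs_singleton.
have h3 : (lam (rmul Am g) + e) * (lam Bm + e) =
  lam (rmul Am g) * lam Bm + e * (lam (rmul Am g) + lam Bm + e) by ring.
have h4 : e * (lam (rmul Am g) + lam Bm + e) <= e * (a' + b + 1).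
  by apply: ler_wpM2l; [exact: ltW|lra].
by lra.
Qed.

(** * The modulus and unimodularity *)

Lemma cinj_nbhs1 : exists U, [/\ open U, U 1%g & cinj U].
Proof.
have [N nN Nl] := discrete_nbhs1; have [W [oW W1 WV WM]] := nbhs1_sqr nN.
exists W; split=> // a b Wa Wb /cpiP Lba.
have /(congr1 (fun x => b * x)%g) := Nl _ (WM _ _ (WV _ Wb) Wa) Lba.
by rewrite mulVKg mulg1.
Qed.

Lemma precpt_nbhs1 : exists U, [/\ open U, U 1%g & precpt U].
Proof.
have [K nK [cK _]] := lcT (I : [set: T] 1%g).
have nK' : nbhs 1%g [set x | [set: T] x -> K x] by exact: nK.
have : nbhs 1%g K by apply: filterS nK' => x; exact.
by rewrite nbhsE => -[U [oU U1] UK]; exists U; split=> //; exists K.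
Qed.

(** [B g = g (g^-1 B g)], so it suffices to shrink [B] until each [g^-1 B g] lies in a neighbourhood
    of 1 on which [cpi] is injective. *)
Lemma cinj_rmul_exists (gs : seq T) : exists B,
  [/\ open B, B 1%g, precpt B & forall g, g \in gs -> cinj (rmul B g)].
Proof.
elim: gs => [|g gs [B [oB B1 pB iB]]].
  by have [U [oU U1 pU]] := precpt_nbhs1; exists U.
have [U [oU U1 iU]] := cinj_nbhs1.
have := nbhs1_conj g (open_nbhs_nbhs (conj oU U1)).
rewrite nbhsE => -[N [oN N1] NU].
exists (B `&` N); split=> //; first exact: openI.
  by apply: precpt_sub pB => x [].
move=> h; rewrite in_cons => /predU1P[->|hgs].
  apply: cinj_sub (cinj_lmul (x := g) iU) => _ [x [_ /NU/= Ux] <-].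
  by apply/lmulP; rewrite mulgA.
by apply: cinj_sub (iB h hgs); apply: rmulS => x [].
Qed.

(** One sample set [A] defines the ratio; [rmul_compare] with [A] and [B] in both orders shows that
    [B] has the same one. *)
Lemma modulus_exists g : exists2 d : R, 0 < d &
  forall B, open B -> precpt B -> cinj B -> cinj (rmul B g) ->
    lam (rmul B g) = d * lam B.
Proof.
have [A [oA A1 pA iA]] := cinj_rmul_exists [:: 1%g; g].
have iA1 : cinj A by rewrite -[A]rmul1; apply: iA; rewrite inE eqxx.
have iAg : cinj (rmul A g) by apply: iA; rewrite !inE eqxx orbT.
have lA := lam_gt0 oA A1.
have lAg : 0 < lam (rmul A g).
  by apply: (@lam_gt0 _ (1 * g)%g); [exact: open_rmul|exists 1%g].
exists (lam (rmul A g) / lam A); first exact: divr_gt0.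
move=> B oB pB iB iBg; apply: (mulfI (lt0r_neq0 lA)).
rewrite [RHS](_ : _ = lam (rmul A g) * lam B); last by field; rewrite gt_eqF.
apply/eqP; rewrite eq_le [X in _ && X]rmul_compare// andbT.
by rewrite mulrC [X in _ <= X]mulrC rmul_compare.
Qed.

(** The images of the sets [h^i U] all have measure [lam U > 0], so they cannot be pairwise disjoint
    in a space of finite measure. *)
Lemma recurrence h U u0 : open U -> U u0 ->
  exists k u u', [/\ (0 < k)%N, U u, U u' & cpi (h ^+ k * u)%g = cpi u'].
Proof.
move=> oU Uu0; apply: contrapT => nex.
pose E i : set XB := cpi @` (lmul (h ^+ i)%g U).
have mE i : measurable (E i) by exact: (measurable_cpi (open_lmul _ oU)).
have sep i j c : (i < j)%N -> E i c -> E j c -> False.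
  move=> ij [_ [u Uu <-] <-] [_ [v Vv <-] e]; apply: nex.
  exists (j - i)%N, v, u; split=> //; first by rewrite subn_gt0.
  apply/cpiP; move/cpiP: e.
  rewrite -{1}(subnKC (ltnW ij)) expgnDr invgM -!mulgA.
  by rewrite (mulgA _ (h ^+ i)%g) mulVg mul1g.
have tE : trivIset setT E.
  apply/trivIsetP => i j _ _ ij; rewrite -subset0 => c [Ei Ej].
  by move: ij; rewrite neq_ltn => /orP[] lt; [exact: (sep i j c)|exact: (sep j i c)].
have lU := lam_gt0 oU Uu0.
have bound n : n%:R * lam U <= mf setT.
  have := mf_bigsetU n mE tE.
  have -> : \sum_(i < n) mf (E i) = n%:R * lam U.
    under eq_bigr do rewrite /E -/(lam _) lam_lmul//.
    by rewrite sumr_const card_ord mulr_natl.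
  by move=> <-; apply: mf_le => //; exact: bigsetU_measurable.
have := bound (Num.truncn (mf setT / lam U)).+1.
by rewrite -ler_pdivlMr// leNgt truncnS_gt.
Qed.

(* T is unimodular: by recurrence h^k = u' l u^-1 with l in L and u, u' near 1,
   so the modulus of h^k is bounded independently of h. *)
Lemma lam_rmul g B : open B -> precpt B -> cinj B -> cinj (rmul B g) ->
  lam (rmul B g) = lam B.
Proof.
have /choice[D hD] (g' : T) : exists d : R, 0 < d /\ forall B, open B ->
    precpt B -> cinj B -> cinj (rmul B g') -> lam (rmul B g') = d * lam B.
  by have [d d0 hd] := modulus_exists g'; exists d.
have D0 x : 0 < D x by case: (hD x).
have DE x := (hD x).2.
have DM x y : D (x * y)%g = D x * D y.
  have [A [oA A1 pA iA]] := cinj_rmul_exists [:: 1; x; x * y]%g.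
  have iA1 : cinj A by rewrite -[A]rmul1; apply: iA; rewrite inE eqxx.
  have iAx : cinj (rmul A x) by apply: iA; rewrite !inE eqxx orbT.
  have iAxy : cinj (rmul A (x * y)%g) by apply: iA; rewrite !inE eqxx !orbT.
  have lA := lam_gt0 oA A1.
  apply: (mulIf (lt0r_neq0 lA)); rewrite -DE// -rmulM DE ?rmulM//.
  - by rewrite DE// mulrCA mulrA.
  - exact: open_rmul.
  - exact: precpt_rmul.
have DL l : L l -> D l = 1.
  move=> Ll; have [A [oA A1 pA iA]] := cinj_rmul_exists [:: 1; l]%g.
  have iA1 : cinj A by rewrite -[A]rmul1; apply: iA; rewrite inE eqxx.
  have iAl : cinj (rmul A l) by apply: iA; rewrite !inE eqxx orbT.
  have lA := lam_gt0 oA A1.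
  by apply: (mulIf (lt0r_neq0 lA)); rewrite -DE// lam_rmulL// mul1r.
have D1 : D 1%g = 1 by apply: DL; case: sL.
have DX x n : D (x ^+ n)%g = D x ^+ n.
  by elim: n => [|n IH]; rewrite ?expg0 ?expr0// expgS exprS DM IH.
have [U1 [oU1 U11 pU1 iU1]] : exists U, [/\ open U, U 1%g, precpt U & cinj U].
  have [A [oA A1 pA iA]] := cinj_rmul_exists [:: 1%g].
  by exists A; split=> //; rewrite -[A]rmul1; apply: iA; rewrite inE.
have [U [oU U11' UV UM]] := nbhs1_sqr (open_nbhs_nbhs (conj oU1 U11)).
have UU1 : U `<=` U1 by move=> u Uu; rewrite -[u]mulg1; exact: UM.
have lU := lam_gt0 oU U11'.
pose C := mf setT / lam U.
(* [U u] lies in [U1], where [cpi] is injective, so [D u * lam U] is the measure of an image in the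
   coset space. *)
have DU u : U u -> D u <= C.
  move=> Uu; rewrite ler_pdivlMr// -DE//.
  - by apply: lam_leT; exact: open_rmul.
  - exact: precpt_sub pU1.
  - exact: cinj_sub iU1.
  - by apply: cinj_sub iU1 => _ [v Uv <-]; exact: UM.
have C0 : 0 < C by rewrite divr_gt0// mfT_gt0.
have bound h : D h <= C * C + 1.
  have [k [u [u' [k0 Uu Uu' /cpiP Ll]]]] := recurrence h oU U11'.
  have : D h ^+ k = D u' * D u^-1%g.
    have -> : D u^-1%g = (D u)^-1.
      apply: (mulIf (lt0r_neq0 (D0 u))).
      by rewrite -DM mulVg D1 mulVf// gt_eqF.
    apply/eqP; rewrite eq_sym -subr_eq0; apply/eqP.
    have := DL _ Ll; rewrite !DM DX.
    have -> : D u'^-1%g = (D u')^-1.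
      apply: (mulIf (lt0r_neq0 (D0 u'))).
      by rewrite -DM mulVg D1 mulVf// gt_eqF.
    move=> e; have -> : D h ^+ k = D u' / D u.
      apply: (mulIf (lt0r_neq0 (D0 u))); rewrite divfK ?gt_eqF//.
      by apply: (mulfI (invr_neq0 (lt0r_neq0 (D0 u')))); rewrite e mulVf ?gt_eqF.
    by rewrite subrr.
  move=> e; have [le1|/ltW gt1] := leP (D h) 1.
    by apply: le_trans le1 _; rewrite lerDr mulr_ge0// ltW.
  apply: (@le_trans _ _ (D h ^+ k)).
    by case: k k0 {e Ll} => // k _; rewrite exprS ler_peMr ?exprn_ege1// ltW.
  rewrite e; apply: (@le_trans _ _ (C * C)); last by rewrite lerDl.
  by apply: ler_pM; [exact: ltW|exact: ltW|exact: DU|apply: DU; exact: UV].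
(* The bound holds for every power of [h], whereas by Bernoulli's inequality [D h ^+ n] is unbounded
   if [D h > 1]. *)
have Dle1 h : D h <= 1.
  rewrite leNgt; apply/negP => lt1.
  pose n := (Num.truncn ((C * C + 1) / (D h - 1))).+1.
  have := bound (h ^+ n)%g; rewrite DX.
  have bern m : 1 + m%:R * (D h - 1) <= D h ^+ m.
    elim: m => [|m IH]; first by rewrite mul0r addr0 expr0.
    rewrite exprS; apply: (@le_trans _ _ (D h * (1 + m%:R * (D h - 1)))).
      rewrite -subr_ge0 -natr1.
      rewrite [X in 0 <= X](_ : _ = m%:R * (D h - 1) ^+ 2); last by ring.
      by rewrite mulr_ge0 ?sqr_ge0.
    by rewrite ler_pM2l.
  have : C * C + 1 < n%:R * (D h - 1).
    by rewrite -ltr_pdivrMr ?subr_gt0// truncnS_gt.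
  by have := bern n; lra.
move=> oB pB iB iBg; rewrite DE//.
have -> : D g = 1; last by rewrite mul1r.
apply/eqP; rewrite eq_le Dle1 /=.
have := Dle1 g^-1%g; have : D g^-1%g * D g = 1 by rewrite -DM mulVg.
by have := D0 g; have := D0 g^-1%g; nra.
Qed.

(** * Tiling the coset space and counting translates of tiles *)

Lemma mf_lift_rmul A k (P : set X) : open A -> precpt A -> cinj A ->
  cinj (rmul A k) -> open P ->
  let F : set XB := cpi @` (rmul (A `&` ~` (cpi @^-1` P)) k) in
  measurable F /\ mf F = mf (cpi @` A `\` P).
Proof.
move=> oA pA iA iAk oP F.
(* The part of [A] outside the preimage of [P] may fail to be open, so [lam_rmul] is applied to the
   open sets [A] and [Q] and the measures are subtracted; injectivity of [cpi] turns the image of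
   the difference into the difference of the images. *)
pose Q := A `&` cpi @^-1` P.
have oQ : open Q by apply: openI => //; rewrite -open_cosetE.
have QA : Q `<=` A by move=> x [].
have FE : F = cpi @` (rmul A k) `\` cpi @` (rmul Q k).
  apply/seteqP; split.
    move=> _ [_ [a [Aa nP] <-] <-]; split; first by exists (a * k)%g => //; exists a.
    move=> [_ [b [Ab Pb] <-] /iAk e].
    have /mulIg ba : (b * k = a * k)%g by apply: e; [exists b|exists a].
    by apply: nP; rewrite -ba.
  move=> _ [[_ [a Aa <-] <-] nQ]; exists (a * k)%g => //; exists a => //.
  by split=> // Pa; apply: nQ; exists (a * k)%g => //; exists a.
have mD (E E' : set XB) : measurable E -> measurable E' -> E' `<=` E ->
    mf (E `\` E') = mf E - mf E'.
  move=> mE mE' EE; apply: EFin_inj; rewrite EFinB !mfK//; last exact: measurableD.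
  have Eoo : (mu E < +oo)%E by rewrite -mfK// ltry.
  by rewrite (measureD mE mE' Eoo) setIidr.
have mAk : measurable (cpi @` (rmul A k) : set XB).
  exact: (measurable_cpi (open_rmul k oA)).
have mQk : measurable (cpi @` (rmul Q k) : set XB).
  exact: (measurable_cpi (open_rmul k oQ)).
split; first by rewrite FE; exact: measurableD.
rewrite FE mD//; last exact/image_subset/rmulS.
have -> : cpi @` A `\` P = cpi @` A `\` cpi @` Q.
  apply/seteqP; split=> _ [[a Aa <-] nP]; split; [by exists a| |by exists a|].
    by move=> [b [Ab Pb] /(iA _ _ Ab Aa) ba]; apply: nP; rewrite -ba.
  by move=> Pa; apply: nP; exists a.
rewrite mD; [|exact: measurable_cpi|exact: measurable_cpi|exact: image_subset].
rewrite -/(lam (rmul A k)) -/(lam (rmul Q k)) !lam_rmul//.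
- exact: precpt_sub pA.
- exact: cinj_sub iA.
- by apply: cinj_sub iAk; exact: rmulS.
Qed.

Variables (G : groupType) (Gam : subgroup G) (iota : {multiplicative G -> T}).
Hypotheses (hecke : hecke_pair Gam) (iota_inj : injective iota).
Hypothesis LE : L = iota @` Gam.

Let iotaV (x : G) : iota x^-1%g = (iota x)^-1%g.
Proof.
have i1 : iota 1%g = 1%g by apply: (mulgI (iota 1%g)); rewrite -gmulfM !mulg1.
by apply: (mulgI (iota x)); rewrite -gmulfM !mulgV.
Qed.

(** Lift disjoint tiles covering almost all of the coset space and translate each on the right by
    the [n'] representatives of the cosets in [dcoset Gam h^-1%g]. By unimodularity the images have
    total measure almost [n' * mf setT], while no point lies in more than [n] of them. *)
Lemma lattice_ncosets_le (h : G) :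
  (ncosets (dcoset Gam h^-1%g) Gam <= ncosets (dcoset Gam h) Gam)%N.
Proof.
have sG := subgroupP Gam; have [G1 GM GV] := sG.
have finh := hecke h; have finhV := hecke h^-1%g.
pose ks : seq (set G) := enum_fset (fset_set (lcosets (dcoset Gam h^-1%g) Gam)).
have ksP c : c \in ks -> lcosets (dcoset Gam h^-1%g) Gam c.
  by move=> cks; have := in_fset_set finhV c; rewrite cks => /esym/set_mem.
pose kk c := iota (xget 1%g c).
have [U [oU U1 pU iU]] := cinj_rmul_exists (1%g :: [seq kk c | c <- ks]).
have iU1 : cinj U by rewrite -[U]rmul1; apply: iU; rewrite mem_head.
have iUk c : c \in ks -> cinj (rmul U (kk c)).
  by move=> cks; apply: iU; rewrite in_cons map_f ?orbT.
set n := ncosets (dcoset Gam h) Gam; set n' := ncosets _ _.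
have sz : size ks = n' by [].
(* If [n < n'], take [e = M / (n + 2)]: then [(n + 1) (M - e)] exceeds [n M] by [M / (n + 2)]. *)
suff key (e : R) : 0 < e -> n'%:R * (mf setT - e) <= n%:R * mf setT.
  rewrite leqNgt; apply/negP => lt.
  have M0 := mfT_gt0; set M := mf setT in key M0.
  have n2 : 0 < n.+2%:R :> R by rewrite ltr0n.
  have := key (M / n.+2%:R) (divr_gt0 M0 n2); apply/negP; rewrite -ltNge.
  have Me : 0 <= M - M / n.+2%:R.
    by rewrite subr_ge0 ler_pdivrMr//; apply: ler_peMr; [exact: ltW|rewrite ler1n].
  apply: (@lt_le_trans _ _ (n.+1%:R * (M - M / n.+2%:R))); last first.
    by rewrite ler_wpM2r// ler_nat.
  rewrite -subr_gt0 [X in 0 < X](_ : _ = M / n.+2%:R); first exact: divr_gt0.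
  have n2' := lt0r_neq0 n2; move: n2'; rewrite -!natr1 => n2'.
  by field.
move=> e0; have [C [cC _ hC]] := inner_compact (@openT X) e0.
have [|s hs] := @compact_finite_cover _ C T (fun g => cpi @` (lmul g U)) cC.
  move=> c _; have [y ->] := cpi_surj c; exists y.
  apply: open_nbhs_nbhs; split; first exact/open_cpi/open_lmul.
  by exists y => //; exists 1%g => //; rewrite mulg1.
pose A i := lmul (nth 1%g s i) U.
have oA i : open (A i) by exact: open_lmul.
have iA i : cinj (A i) by exact: cinj_lmul.
pose O i : set XB := cpi @` (A i).
pose P i : set X := \big[setU/set0]_(k < i) O k.
have oP i : open (P i).
  rewrite /P -bigcup_mkord.
  by apply: bigcup_open => k _; exact: (open_cpi (oA k)).
pose E := seqDU O.
have mO i : measurable (O i) by exact: (measurable_cpi (oA i)).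
have mE i : measurable (E i) by exact: seqDU_measurable.
have tE := trivIset_seqDU O.
(* [B i] lifts the tile [E i] to [A i], on which [cpi] is injective. *)
pose B i := A i `&` ~` (cpi @^-1` (P i)).
have BE i b : B i b -> E i (cpi b) by move=> [Ab nP]; split=> //; exists b.
pose F p : set XB := cpi @` (rmul (B p.1) (kk p.2)).
have FP i c : c \in ks -> measurable (F (i, c)) /\ mf (F (i, c)) = mf (E i).
  move=> cks; apply: mf_lift_rmul => //; first exact: precpt_lmul.
  by rewrite /A -lmul_rmul; apply: cinj_lmul; exact: iUk.
pose prs := [seq (i, c) | i <- index_iota 0 (size s), c <- ks].
have uprs : uniq prs.
  by apply: allpairs_uniq; [exact: iota_uniq|exact: fset_uniq|case=> ? ? [? ?]].
have prsP p : p \in prs -> p.2 \in ks.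
  by move=> /allpairsP[[i c] [_ cks ->]].
(* If the coset of [z] lies in the image of [B_i k], then [z y] is in [B_i] for some [y] in
   [Gam k^-1], so [y] lies in [dcoset Gam h]. The pair is sent to the coset [y Gam], one of [n]. *)
have count_le (d : XB) : (count (fun p => d \in F p) prs <= n)%N.
  have [z ->] := cpi_surj d; rewrite -size_filter; set fl := seq.filter _ _.
  have flP p : p \in fl -> p.2 \in ks /\ exists y : G,
      [/\ B p.1 (z * iota y)%g & exists2 l, (Gam : set G) l & y = (l * (xget 1 p.2)^-1)%g].
    rewrite mem_filter => /andP[/set_mem[_ [b Bb <-] /esym/cpiP zb] pp].
    split; first exact: prsP.
    move: zb; rewrite LE => -[l Gl el]; exists (l^-1 * (xget 1 p.2)^-1)%g; split.
      rewrite gmulfM !iotaV el -/(kk _) !invgM !invgK.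
      by rewrite -!mulgA !mulVKg mulgV mulg1.
    by exists l^-1%g => //; exact: GV.
  have /choice[y hy] p : exists y : G, p \in fl -> B p.1 (z * iota y)%g /\
      exists2 l, (Gam : set G) l & y = (l * (xget 1 p.2)^-1)%g.
    have [/flP[_ [y [By hl]]]|_] := boolP (p \in fl); last by exists 1%g.
    by exists y.
  have yin p : p \in fl -> dcoset Gam h (y p).
    move=> pf; have [_ [l Gl ->]] := hy p pf; apply: dcosetMl => //.
    rewrite -[h]invgK; apply: dcosetV => //.
    apply: (coset_rep_in sG (rinv_dcoset (g := h^-1%g) sG (@subset_refl _ Gam))).
    by apply: ksP; case: (flP p pf).
  (* The coset [y Gam] fixes the image of [z y], hence the tile by disjointness, then [y] by
     injectivity on [A i], and finally [k Gam = y^-1 Gam]. *)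
  have inj : {in fl &, injective (fun p => lcoset (y p) Gam)}.
    move=> [i c] [j d'] pf qf /= /lcoset_eqP-/(_ sG) Gl.
    have [/= Bp [l Gl1 ep]] := hy _ pf; have [/= Bq [l' Gl2 eq]] := hy _ qf.
    have ecpi : cpi (z * iota (y (i, c)))%g = cpi (z * iota (y (j, d')))%g.
      apply/cpiP; rewrite LE; exists ((y (j, d'))^-1 * y (i, c))%g => //.
      by rewrite gmulfM iotaV invgM -mulgA mulKg.
    have ij : i = j.
      apply: (tE _ _ I I); exists (cpi (z * iota (y (i, c)))%g); split.
        exact: BE.
      by rewrite ecpi; exact: BE.
    rewrite -ij in qf Bq ecpi eq *; congr pair.
    have /mulgI/iota_inj ey := iA i _ _ Bp.1 Bq.1 ecpi.
    move: ey; rewrite ep eq => ey.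
    have /= hc := ksP _ (flP _ pf).1; have /= hd := ksP _ (flP _ qf).1.
    rewrite -(coset_repK sG hc) -(coset_repK sG hd); apply/lcoset_eqP => //=.
    have -> : ((xget 1 d')^-1 * xget 1 c = l'^-1 * l)%g.
      apply: (mulgI l'); rewrite mulgA -ey !mulgA mulgVK mulgV mul1g //.
    by apply: GM => //; exact: GV.
  rewrite -(size_map (fun p => lcoset (y p) Gam)) /n /ncosets.
  apply: uniq_leq_size.
    by rewrite map_inj_in_uniq// filter_uniq.
  move=> _ /mapP[p pf ->]; rewrite in_fset_set// inE.
  by exists (y p) => //; exact: yin.
have := @mf_step_le [seq (1, F p) | p <- prs] [:: (n%:R, setT)].
rewrite big_seq1 big_map /= => H.
have {}H : \sum_(p <- prs) 1 * mf (F p) <= n%:R * mf setT.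
  apply: H.
  - move=> q /mapP[[i c] pp ->] /=; split=> //.
    by have [mF _] := FP i c (prsP _ pp); exact: mF.
  - by move=> q; rewrite inE => /eqP-> /=.
  move=> d; rewrite big_seq1 big_map /= indicE in_setT mulr1.
  rewrite [X in X <= _](_ : _ = (count (fun p => d \in F p) prs)%:R) ?ler_nat//.
  rewrite -sum1_count natr_sum [RHS]big_mkcond; apply: eq_bigr => p _.
  by rewrite mul1r indicE; case: (d \in F p).
apply: le_trans H; rewrite big_allpairs_dep /=.
rewrite (eq_bigr (fun i => n'%:R * mf (E i))); last first.
  move=> i _; rewrite (eq_big_seq (fun=> mf (E i))); last first.
    by move=> c cks; rewrite mul1r; case: (FP i c cks).
  by rewrite big_const_seq count_predT iter_addr_0 sz mulr_natl.
rewrite -mulr_sumr ler_wpM2l// big_mkord -mf_bigsetU//.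
rewrite lerBlDr; apply: (le_trans (ltW hC)); rewrite lerD2r.
apply: mf_le; [exact: measurable_compact|exact: bigsetU_measurable|].
move=> c /hs[x xs Ox]; rewrite -bigsetU_seqDU -bigcup_mkord.
by exists (index x s); rewrite /= ?index_mem// /O /A nth_index.
Qed.

Lemma lattice_ncosets_eq (h : G) :
  ncosets (dcoset Gam h) Gam = ncosets (dcoset Gam h^-1%g) Gam.
Proof.
apply/eqP; rewrite eqn_leq lattice_ncosets_le andbT.
by have := lattice_ncosets_le h^-1%g; rewrite invgK.
Qed.

End LatticeMeasure.

(** * Equal degrees, and the four assertions *)

Lemma hecke_adjoint_unimodular (R : realType) (G : groupType) (Gam : subgroup G)
    (hecke : hecke_pair Gam) (V : gmodType R[i] G)
    (U : unitary_hecke_module V Gam) (q : nat) (q_gt0 : (0 < q)%N) (g : G) :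
  ncosets (dcoset Gam g) Gam = ncosets (dcoset Gam g^-1%g) Gam ->
  is_adjoint (@Lip _ _ _ _ U q) (hecke_op g) (hecke_op g^-1%g).
Proof.
(* At level [Gam] itself the ratio is the quotient of the two degrees, which is 1 by [e]. *)
move=> e x y; rewrite (hecke_adjoint hecke U q_gt0 (ncongT Gam) g x y) /= e.
rewrite divff ?scale1r// pnatr_eq0 -lt0n.
by apply: ncosets_gt0 (hecke _) (dcoset_refl _ _); exact: subgroupP.
Qed.

Theorem theorem1p3p1 (R : realType) (G : groupType) (Gam : subgroup G)
    (HGam : hecke_pair Gam)
    (V : gmodType R[i] G) (U : unitary_hecke_module V Gam)
    (q : nat) (q_ge1 : (1 <= q)%N) (g : G) :
  let T (h : G) : Lq V Gam q -> Lq V Gam q := hecke_op h in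
  let ip : Lq V Gam q -> Lq V Gam q -> R[i] := Lip U (q := q) in
  [/\ (* (1) *)
      bounded_operator ip (T g) /\
      opnorm ip (T g) <= (ncosets (dcoset Gam g) Gam)%:R,
      (* (2) *)
      forall S : ncong Gam,
        let r : R[i] := (ncosets (dcoset S g) S)%:R /
                        (ncosets (dcoset S (g^-1)%g) S)%:R in
        (forall v w : Hbar V q S,
           ip (T g (Lin v)) (Lin w) = r * ip (Lin v) (T (g^-1)%g (Lin w))) /\
        is_adjoint ip (T g) (fun x => r *: T (g^-1)%g x),
      (* (3) *)
      dcoset Gam g = dcoset Gam (g^-1)%g -> self_adjoint ip (T g)
    & (* (4) *)
      forall (Gs : topologicalGroupType) (iota : {multiplicative G -> Gs}),
        locally_compact_group Gs -> injective iota ->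
        lattice R (iota @` Gam) ->
        forall h : G, is_adjoint ip (T h) (T (h^-1)%g)].
Proof.
move=> T ip; split.
- exact: hecke_op_opnorm.
- move=> S r; split; last exact: hecke_adjoint.
  move=> v w; have [v' vS ->] := Hcls_rep v; have [w' wS ->] := Hcls_rep w.
  exact: hecke_adjoint_ncong.
(* Equal double cosets give equal degrees and also the same operator for [g] and [g^-1]. *)
- move=> e x y; rewrite /ip /T.
  rewrite (hecke_adjoint_unimodular HGam U q_ge1); last by rewrite -e.
  by rewrite -(hecke_op_dcoset HGam _ e).
- move=> Gs iota [hausGs lcGs] iota_inj [sL dL [mu [rad mu_gt0 mu_inv]]] h.
  apply: hecke_adjoint_unimodular => //.
  exact: (lattice_ncosets_eq hausGs lcGs sL dL rad mu_gt0 mu_inv HGam iota_inj erefl).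
Qed.
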